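(* Let $d\ge 2$, $\mu\in\mathbb{S}^{d-1}$, $\kappa\ge 0$, and let $X$ follow the Power Spherical distribution with direction $\mu$ and concentration $\kappa$. With $\alpha=\frac{d-1}{2}+\kappa$, $\beta=\frac{d-1}{2}$ and $N_X(\kappa,d) = 2^{\alpha+\beta}\pi^{\beta}\frac{\Gamma(\alpha)}{\Gamma(\alpha+\beta)}$, the differential entropy of $X$ (with respect to surface measure on $\mathbb{S}^{d-1}$) is $$\operatorname{H}(X) = \log N_X(\kappa,d) - \kappa\big(\log 2 + \psi(\alpha) - \psi(\alpha+\beta)\big).$$
   Context: The Power Spherical distribution with direction $\mu\in\mathbb{S}^{d-1}$ and concentration $\kappa\ge 0$ is the probability distribution on $\mathbb{S}^{d-1}=\{x\in\mathbb{R}^d:\|x\|_2=1\}$ with density (w.r.t. surface measure) proportional to $(1+\mu^\top x)^\kappa$. $\psi(x)=\frac{d}{dx}\log\Gamma(x)$ is the digamma function; differential entropy is $\operatorname{H}(X) = -\mathbb{E}[\log p_X(X)]$. *)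

(* Defs.v *)
From HB Require Import structures.
From mathcomp Require Import all_boot all_order all_algebra.
From mathcomp Require Import all_classical all_reals all_analysis.
Set Implicit Arguments. Unset Strict Implicit. Unset Printing Implicit Defensive.
Import Order.TTheory GRing.Theory Num.Theory.
Import numFieldNormedType.Exports.
Local Open Scope classical_set_scope.
Local Open Scope ring_scope.

Section PowerSpherical.
Context {R : realType}.

Definition Gamma (a : R) : R :=
  Rintegral lebesgue_measure `]0%R, +oo[ (fun t : R => t `^ (a - 1) * expR (- t)).

Definition digamma (a : R) : R := derive1 (fun x : R => ln (Gamma x)) a.

Definition dotv (d : nat) (x y : d.-tuple R) : R :=
  \sum_(i < d) tnth x i * tnth y i.

Definition normv (d : nat) (x : d.-tuple R) : R := Num.sqrt (dotv x x).

Definition scalev (d : nat) (c : R) (x : d.-tuple R) : d.-tuple R :=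
  map_tuple (fun a => c * a) x.

(** Lebesgue integral over R^d, computed as an iterated integral of
    one-dimensional Lebesgue integrals (Fubini).  Used below only for
    bounded measurable integrands with bounded support. *)
Fixpoint lebesgue_int (n : nat) : (n.-tuple R -> R) -> R :=
  match n with
  | 0 => fun f => f [tuple]
  | n'.+1 => fun f =>
      Rintegral lebesgue_measure setT
        (fun x : R => lebesgue_int (fun t : n'.-tuple R => f (cons_tuple x t)))
  end.

(** Integral with respect to the surface measure sigma on S^{d-1}, via the
    cone construction:  int_{S^{d-1}} g dsigma
        = d * int_{ {x in R^d | 0 < |x| <= 1} } g(x/|x|) dx. *)
Definition sphere_integral (d : nat) (g : d.-tuple R -> R) : R :=
  d%:R * lebesgue_int (fun x : d.-tuple R =>
    let r := normv x in
    if (0 < r) && (r <= 1) then g (scalev r^-1 x) else 0).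

Definition ps_unnorm (d : nat) (mu : d.-tuple R) (kappa : R) (x : d.-tuple R) : R :=
  (1 + dotv mu x) `^ kappa.

Definition ps_normalizer (d : nat) (mu : d.-tuple R) (kappa : R) : R :=
  sphere_integral (ps_unnorm mu kappa).

Definition ps_density (d : nat) (mu : d.-tuple R) (kappa : R) (x : d.-tuple R) : R :=
  ps_unnorm mu kappa x / ps_normalizer mu kappa.

(** Differential entropy H(X) = - E[log p_X(X)] = - int p log p dsigma
    (with the convention 0 log 0 = 0, which holds since ln 0 = 0 here). *)
Definition ps_entropy (d : nat) (mu : d.-tuple R) (kappa : R) : R :=
  - sphere_integral (fun x => ps_density mu kappa x * ln (ps_density mu kappa x)).

Definition ps_alpha (d : nat) (kappa : R) : R := (d%:R - 1) / 2 + kappa.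
Definition ps_beta (d : nat) : R := (d%:R - 1) / 2.

Definition NX (kappa : R) (d : nat) : R :=
  2 `^ (ps_alpha d kappa + ps_beta d) * pi `^ (ps_beta d)
  * (Gamma (ps_alpha d kappa) / Gamma (ps_alpha d kappa + ps_beta d)).

End PowerSpherical.

(* Main.v *)
(** Idea.  Only the squared norm and the linear form [mu . x] occur in the
    integrand, and a sequence of plane rotations replaces [mu . x] by the first
    coordinate.  Write [x = (x1, y)] with [y] in R^(d-1).  The substitution
    [p = x1 + |x|], [z = y / p] (stereographic coordinates, scaled by [p])
    turns the cone integral of [g(mu . x / |x|)] into the integral over [z] of
    [g((1 - |z|^2) / (1 + |z|^2)) * (2 / (1 + |z|^2))^(d-1)].  For
    [g(t) = (1 + t)^kappa] only the moments of [(1 + |z|^2)^(-a)] are needed; by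
    the Gamma integral they are Gaussian integrals, equal to
    [V(a) = pi^b * Gamma(a - b) / Gamma(a)] with [b = (d-1)/2].  The logarithmic
    moment in the entropy is [- V'(a)]: since [x^(-h) >= 1 - h ln x], its opposite
    is the slope of a supporting line of [V] at [a], so that no differentiation
    under the iterated integral is needed. *)
Require Import Defs.
From HB Require Import structures.
From mathcomp Require Import all_boot all_order all_algebra.
From mathcomp Require Import all_classical all_reals all_analysis.
From mathcomp Require Import measurable_realfun ring lra.
Set Implicit Arguments. Unset Strict Implicit. Unset Printing Implicit Defensive.
Import Order.TTheory GRing.Theory Num.Theory.
Import numFieldNormedType.Exports.
Local Open Scope classical_set_scope.
Local Open Scope ring_scope.

(** * Affine substitutions and plane rotations *)

Section AffineChange.
Context {R : realType}.
Local Notation mu := (@lebesgue_measure R).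

(** The surface integral is an iterated integral of real functions, and [Rintegral] is additive only
    for integrable ones. All changes of variables are therefore made on nonnegative extended-real
    integrands, where Tonelli asks for measurability alone. The signed integral is brought there
    once: p log p is a combination of u and - u ln u, with u the density rescaled to values in
    [0, 1], and both are nonnegative and bounded. Only one variable is changed at a time;
    stereographic coordinates suit this, because p is a substitution in x1 at fixed |y|, z is a
    scaling of y at fixed p, and the radius becomes rational. Since [digamma] is a [derive1], it
    says something only where Gamma is derivable, which is why the Gamma integral has to be
    differentiated. *)

Lemma measurable_integral d (T : measurableType d) (f : T * R -> \bar R) :
  measurable_fun setT f -> (forall z, 0 <= f z)%E ->
  measurable_fun setT (fun x => \int[mu]_y f (x, y))%E.
Proof.
move=> mf f0.
(* [R] and [measurableTypeR R] carry convertible, syntactically distinct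
   measurable structures. *)
have h : @measurable_fun _ _ (T * measurableTypeR R)%type _ setT f by exact: mf.
by have := @measurable_fun_fubini_tonelli_F _ _ T (measurableTypeR R) R mu f h f0.
Qed.

Lemma lebesgue_tonelli (f : R * R -> \bar R) :
  measurable_fun setT f -> (forall z, 0 <= f z)%E ->
  (\int[mu]_x \int[mu]_y f (x, y) = \int[mu]_y \int[mu]_x f (x, y))%E.
Proof.
move=> mf f0.
have h : @measurable_fun _ _ (measurableTypeR R * measurableTypeR R)%type _ setT f
  by exact: mf.
by have := @fubini_tonelli _ _ (measurableTypeR R) (measurableTypeR R) R mu mu f h f0.
Qed.

(** Both sides are measures that agree on half-open intervals, and this characterises Lebesgue
    measure. For negative [c] the preimage of such an interval is closed at the other end, with the
    same length. *)
Lemma lebesgue_measure_affine (c b : R) (A : set R) : c != 0 -> measurable A ->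
  (`|c|%:E * mu ((fun x => c * x + b)%R @^-1` A) = mu A)%E.
Proof.
move=> c0 mA.
have mphi : @measurable_fun _ _ (measurableTypeR R) (measurableTypeR R) setT
    (fun x => c * x + b).
  by apply: measurable_funD => //; exact: measurable_funM.
pose nu : {measure set (measurableTypeR R) -> \bar R} :=
  measure_function_pushforward__canonical__measure_function_Measure mu mphi.
pose k := NngNum (normr_ge0 c).
transitivity (mscale k nu A) => //.
apply/esym/lebesgue_measure_unique => //= _ [[x y]] _ <-.
rewrite /mscale/= /pushforward/=.
have [cgt|clt|/eqP] := ltgtP 0 c; last by rewrite eq_sym (negbTE c0).
- rewrite (_ : _ @^-1` _ = `](x - b) / c, (y - b) / c]%classic); last first.
    apply/seteqP; split=> z; rewrite /= !in_itv/= ltr_pdivrMr// ler_pdivlMr//;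
      by rewrite ltrBlDr lerBrDr (mulrC z).
  rewrite !lebesgue_measure_itv/= !lte_fin ltr_pM2r ?invr_gt0// ltrD2r.
  case: ifPn => _; last by rewrite mule0.
  by rewrite !EFinN -!EFinD -EFinM gtr0_norm//; congr EFin; field.
- rewrite (_ : _ @^-1` _ = `[(y - b) / c, (x - b) / c[%classic); last first.
    apply/seteqP; split=> z; rewrite /= !in_itv/= ltr_ndivlMr// ler_ndivrMr//;
      by rewrite ltrBlDr lerBrDr (mulrC z) andbC.
  rewrite !lebesgue_measure_itv/= !lte_fin ltr_nM2r ?invr_lt0// ltrD2r.
  case: ifPn => _; last by rewrite mule0.
  by rewrite !EFinN -!EFinD -EFinM ltr0_norm//; congr EFin; field.
Qed.

Lemma integral_affine (c b : R) (f : R -> \bar R) : c != 0 ->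
  measurable_fun setT f -> (forall x, 0 <= f x)%E ->
  (\int[mu]_x f (c * x + b)%R = (`|c|^-1)%:E * \int[mu]_x f x)%E.
Proof.
move=> c0 mf f0.
have mphi : @measurable_fun _ _ (measurableTypeR R) (measurableTypeR R) setT
    (fun x => c * x + b).
  by apply: measurable_funD => //; exact: measurable_funM.
pose nu : {measure set (measurableTypeR R) -> \bar R} :=
  measure_function_pushforward__canonical__measure_function_Measure mu mphi.
pose k := NngNum (normr_ge0 c).
have -> : (\int[mu]_x f x = \int[mscale k nu]_x f x)%E.
  by apply: eq_measure_integral => A mA _; rewrite /= -(lebesgue_measure_affine b c0 mA).
rewrite ge0_integral_mscale// ge0_integral_pushforward// preimage_setT muleA.
by rewrite -EFinM mulVf ?mul1e// normr_eq0.
Qed.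

(* The substitutions [y = (ru - cx)/e] and then [x = (cu - ev)/r] are affine in
   one variable at a time, so that Tonelli suffices. *)
Lemma integral_rotation (c e : R) (K : R * R -> \bar R) :
  measurable_fun setT K -> (forall z, 0 <= K z)%E ->
  (\int[mu]_x \int[mu]_y K (x ^+ 2 + y ^+ 2, c * x + e * y)%R =
   \int[mu]_u \int[mu]_v K (u ^+ 2 + v ^+ 2, Num.sqrt (c ^+ 2 + e ^+ 2) * u)%R)%E.
Proof.
move=> mK K0.
have mR2 (g h : R * R -> R) : measurable_fun setT g -> measurable_fun setT h ->
    measurable_fun setT (fun z => K (g z, h z)).
  by move=> mg mh; apply: measurableT_comp => //; exact: measurable_fun_pair.
(* The general substitutions divide by [e]. Here only the sign of [c] is left, removed by the
   reflection x -> -x. *)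
have [->|e0] := eqVneq e 0.
  rewrite expr0n addr0 sqrtr_sqr.
  have [c0|c0] := ger0P c.
    by apply: eq_integral => x _; apply: eq_integral => y _; rewrite mul0r addr0.
  pose f x := (\int[mu]_y K (x ^+ 2 + y ^+ 2, c * x)%R)%E.
  transitivity (\int[mu]_x f x)%E.
    by apply: eq_integral => x _; apply: eq_integral => y _; rewrite mul0r addr0.
  transitivity (\int[mu]_x f (-1 * x + 0)%R)%E.
    rewrite integral_affine ?oppr_eq0 ?oner_eq0//.
    - by rewrite normrN1 invr1 mul1e.
    - refine (measurable_integral
        (f := fun z : R * R => K (z.1 ^+ 2 + z.2 ^+ 2, c * z.1)) _ _) => //.
      by apply: mR2; [apply: measurable_funD|apply: measurable_funM] => //;
        apply: measurable_funX.
    - by move=> x; apply: integral_ge0.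
  apply: eq_integral => x _; apply: eq_integral => y _.
  by rewrite addr0 mulN1r sqrrN mulrN mulNr.
set r := Num.sqrt _.
have r2 : r ^+ 2 = c ^+ 2 + e ^+ 2 by rewrite sqr_sqrtr// addr_ge0// sqr_ge0.
have rn0 : r != 0.
  by rewrite -sqrf_eq0 r2 paddr_eq0 ?sqr_ge0// !sqrf_eq0 (negbTE e0) andbF.
have r0 : 0 < r by rewrite lt_neqAle eq_sym rn0 sqrtr_ge0.
have aff1 x : (\int[mu]_y K (x ^+ 2 + y ^+ 2, c * x + e * y)%R =
    (`|r / e|)%:E *
    \int[mu]_u K (x ^+ 2 + (r / e * u + (- c * x / e)) ^+ 2, r * u)%R)%E.
  pose f y := K (x ^+ 2 + y ^+ 2, c * x + e * y).
  transitivity ((`|r / e|)%:E * \int[mu]_u f (r / e * u + (- c * x / e))%R)%E.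
    rewrite integral_affine ?mulf_neq0 ?invr_eq0//.
    - by rewrite muleA -EFinM divff ?mul1e// normr_eq0 mulf_neq0 ?invr_eq0.
    - apply: measurableT_comp => //; apply: measurable_fun_pair.
        by apply: measurable_funD => //; apply: measurable_funX.
      by apply: measurable_funD => //; apply: measurable_funM.
    - by move=> y; exact: K0.
  congr (_ * _)%E; apply: eq_integral => u _; rewrite /f; congr (K (_, _)).
  by field.
under eq_integral => x _ do rewrite aff1.
pose G z := K (z.1 ^+ 2 + (r / e * z.2 + (- c * z.1 / e)) ^+ 2, r * z.2).
have mG : measurable_fun setT G.
  apply: mR2; last by apply: measurable_funM.
  apply: measurable_funD; first by apply: measurable_funX.
  apply: measurable_funX; apply: measurable_funD; first by apply: measurable_funM.
  by apply: measurable_funM => //; apply: measurable_funM.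
rewrite ge0_integralZl//=; last 2 first.
  by apply: (measurable_integral mG) => z; exact: K0.
  by move=> x _; apply: integral_ge0 => y _; exact: K0.
(* With [u] outside, x is affine in the remaining variable v; the Jacobians |r/e| and |e/r|
   cancel. *)
rewrite (lebesgue_tonelli mG)//; last by move=> z; exact: K0.
rewrite -ge0_integralZl//; last 2 first.
  refine (measurable_integral (f := fun z : R * R => G (z.2, z.1)) _ _).
    by apply: measurableT_comp => //; exact: measurable_fun_pair.
  by move=> z; exact: K0.
  by move=> x _; apply: integral_ge0 => y _; exact: K0.
apply: eq_integral => u _; rewrite /G/=.
have re : - (e / r) != 0 by rewrite oppr_eq0 mulf_neq0 ?invr_eq0.
pose f x := K (x ^+ 2 + (r / e * u + (- c * x / e)) ^+ 2, r * u).
transitivity (\int[mu]_v f (- (e / r) * v + c * u / r)%R)%E.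
  rewrite integral_affine//; last 2 first.
  - apply: measurableT_comp => //; apply: measurable_fun_pair => //.
    apply: measurable_funD; first by apply: measurable_funX.
    apply: measurable_funX; apply: measurable_funD => //.
    by apply: measurable_funM => //; apply: measurable_funM.
  - by move=> x; exact: K0.
  by rewrite normrN -normfV invf_div.
apply: eq_integral => v _; rewrite /f; congr (K (_, _)).
have e2 : c ^+ 2 = r ^+ 2 - e ^+ 2 by rewrite r2; ring.
have -> : r / e * u + - c * (- (e / r) * v + c * u / r) / e =
    (e * u + c * v) / r.
  by rewrite -[e * u](mulfK e0); field: e2; rewrite rn0 e0.
by field: e2.
Qed.

End AffineChange.

(** * Iterated integrals of functions of the norm and of a linear form *)

Section Radial.
Context {R : realType}.
Local Notation mu := (@lebesgue_measure R).
Local Open Scope ereal_scope.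
Implicit Types (n : nat) (G H : R -> \bar R) (a : R) (l : seq R) (F : R * R -> \bar R).

(* [radial_integral n G a] is the integral of [G (a + |y|^2)] over [y] in R^n. *)
Fixpoint radial_integral (n : nat) (G : R -> \bar R) (a : R) : \bar R :=
  if n is n'.+1 then \int[mu]_v radial_integral n' G (a + v ^+ 2)%R else G a.

Lemma radial_integral_ge0 n G a : (forall s, 0 <= G s) -> 0 <= radial_integral n G a.
Proof.
by move=> G0; elim: n a => [|n IHn] a//=; apply: integral_ge0 => v _; exact: IHn.
Qed.

Lemma eq_radial_integral n G H a : (forall s, (a <= s)%R -> G s = H s) ->
  radial_integral n G a = radial_integral n H a.
Proof.
elim: n a => [|n IHn] a GH/=; first exact: GH.
apply: eq_integral => v _; apply: IHn => s avs; apply: GH.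
by apply: le_trans avs; rewrite lerDl sqr_ge0.
Qed.

Lemma measurable_radial_integral_param d (T : measurableType d) n
    (G : T * R -> \bar R) (f : T -> R) :
  measurable_fun setT G -> (forall z, 0 <= G z) -> measurable_fun setT f ->
  measurable_fun setT (fun x => radial_integral n (fun s => G (x, s)) (f x)).
Proof.
(* Joint measurability in the parameter and the base point is what the induction carries, as each
   step shifts the base point by the square of a new variable. *)
move=> mG G0 mf; suff mW : measurable_fun setT
    (fun z : T * R => radial_integral n (fun s => G (z.1, s)) z.2).
  refine (measurableT_comp mW (g := fun x => (x, f x)) _).
  exact: measurable_fun_pair.
elim: n => [|n IHn] /=.
  by apply: measurableT_comp => //; exact: measurable_fun_pair.
refine (measurable_integral (f := fun z : T * R * R => radial_integral n
  (fun s => G (z.1.1, s)) (z.1.2 + z.2 ^+ 2)%R) _ _); last first.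
  by move=> z; exact: radial_integral_ge0.
refine (measurableT_comp IHn
  (g := fun z : T * R * R => (z.1.1, (z.1.2 + z.2 ^+ 2)%R)) _).
apply: measurable_fun_pair; first exact: measurableT_comp.
apply: measurable_funD; first exact: measurableT_comp.
exact: measurable_funX.
Qed.

Lemma measurable_radial_integral d (T : measurableType d) n (G : R -> \bar R) (f : T -> R) :
  measurable_fun setT G -> (forall s, 0 <= G s) -> measurable_fun setT f ->
  measurable_fun setT (fun x => radial_integral n G (f x)).
Proof.
move=> mG G0 mf.
refine (measurable_radial_integral_param (G := fun z : T * R => G z.2) n _ _ mf) => //.
exact: measurableT_comp.
Qed.

Lemma measurable_addsqr (a : R) : measurable_fun setT (fun v : R => (a + v ^+ 2)%R).
Proof. by apply: measurable_funD => //; exact: measurable_funX. Qed.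

Lemma le_radial_integral n G H a : measurable_fun setT G -> measurable_fun setT H ->
  (forall s, 0 <= G s) -> (forall s, 0 <= H s) ->
  (forall s, (a <= s)%R -> G s <= H s) ->
  radial_integral n G a <= radial_integral n H a.
Proof.
move=> mG mH G0 H0; elim: n a => [|n IHn] a GH /=; first exact: GH.
apply: ge0_le_integral => //.
- by move=> v _; exact: radial_integral_ge0.
- by apply: measurable_radial_integral => //; exact: measurable_addsqr.
- by apply: measurable_radial_integral => //; exact: measurable_addsqr.
- move=> v _; apply: IHn => s avs; apply: GH.
  by apply: le_trans avs; rewrite lerDl sqr_ge0.
Qed.

(** With at least one variable, the value at [a] itself is seen only from v = 0, a null set. The
    stereographic substitution relies on this, being made for s > 0. *)
Lemma radial_integralS_eq n G H a : measurable_fun setT G -> measurable_fun setT H ->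
  (forall s, 0 <= G s) -> (forall s, 0 <= H s) ->
  (forall s, (a < s)%R -> G s = H s) ->
  radial_integral n.+1 G a = radial_integral n.+1 H a.
Proof.
move=> mG mH G0 H0 GH; apply: ae_eq_integral => //.
- by apply: measurable_radial_integral => //; exact: measurable_addsqr.
- by apply: measurable_radial_integral => //; exact: measurable_addsqr.
exists [set 0%R]; split => //; first exact: lebesgue_measure_set1.
move=> v /= /not_implyP[_ Wv]; apply: contrapT => /eqP v0; apply: Wv.
apply: eq_radial_integral => s avs; apply: GH; apply: lt_le_trans avs.
by rewrite ltrDl lt_neqAle sqr_ge0 eq_sym sqrf_eq0 v0.
Qed.

Lemma radial_integralZl n G a (k : R) : measurable_fun setT G -> (forall s, 0 <= G s) ->
  (0 <= k)%R ->
  radial_integral n (fun s => k%:E * G s) a = k%:E * radial_integral n G a.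
Proof.
move=> mG G0 k0; elim: n a => [|n IHn] a //=.
under eq_integral => v _ do rewrite IHn.
rewrite ge0_integralZl// => [|v _]; last exact: radial_integral_ge0.
by apply: measurable_radial_integral => //; exact: measurable_addsqr.
Qed.

Lemma radial_integralD n G H a : measurable_fun setT G -> measurable_fun setT H ->
  (forall s, 0 <= G s) -> (forall s, 0 <= H s) ->
  radial_integral n (fun s => G s + H s) a = radial_integral n G a + radial_integral n H a.
Proof.
move=> mG mH G0 H0; elim: n a => [|n IHn] a //=.
under eq_integral => v _ do rewrite IHn.
rewrite ge0_integralD// => [v _|?|v _|?].
- exact: radial_integral_ge0.
- by apply: measurable_radial_integral => //; exact: measurable_addsqr.
- exact: radial_integral_ge0.
- by apply: measurable_radial_integral => //; exact: measurable_addsqr.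
Qed.

Lemma radial_integral_shift n G (c a : R) :
  radial_integral n G (c + a)%R = radial_integral n (fun s => G (c + s)%R) a.
Proof.
elim: n a => [|n IHn] a //=.
by apply: eq_integral => v _; rewrite -addrA IHn.
Qed.

Lemma radial_integral_tonelli n (G : R * R -> \bar R) a :
  measurable_fun setT G -> (forall z, 0 <= G z) ->
  \int[mu]_x radial_integral n (fun s => G (x, s)) a =
  radial_integral n (fun s => \int[mu]_x G (x, s)) a.
Proof.
move=> mG G0; elim: n a => [|n IHn] a //=.
under [RHS]eq_integral => v _ do rewrite -IHn.
refine (lebesgue_tonelli
  (f := fun z : R * R => radial_integral n (fun s => G (z.1, s)) (a + z.2 ^+ 2)%R) _ _).
  refine (measurable_radial_integral_param (G := fun z : R * R * R => G (z.1.1, z.2)) n _ _ _).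
  - apply: measurableT_comp => //; apply: measurable_fun_pair => //.
    exact: measurableT_comp.
  - by move=> z; exact: G0.
  - by apply: (measurableT_comp (measurable_addsqr a)).
by move=> z; exact: radial_integral_ge0.
Qed.

Lemma radial_integral_scale n G a (c : R) : measurable_fun setT G ->
  (forall s, 0 <= G s) -> (0 < c)%R ->
  radial_integral n (fun s => G (c ^+ 2 * s)%R) a =
  (c ^- n)%:E * radial_integral n G (c ^+ 2 * a)%R.
Proof.
move=> mG G0 c0; elim: n a => [|n IHn] a; first by rewrite expr0 invr1 mul1e.
rewrite /=; under eq_integral => v _ do rewrite IHn mulrDr -exprMn.
pose f v := radial_integral n G (c ^+ 2 * a + v ^+ 2)%R.
have mf : measurable_fun setT f.
  by apply: measurable_radial_integral => //; exact: measurable_addsqr.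
have f0 v : 0 <= f v by exact: radial_integral_ge0.
transitivity (\int[mu]_v ((c ^- n)%:E * f (c * v + 0)%R)).
  by apply: eq_integral => v _; rewrite /f addr0.
rewrite ge0_integralZl//; last 2 first.
  apply: measurableT_comp => //; apply: measurable_funD => //.
  by rewrite lee_fin invr_ge0 exprn_ge0// ltW.
rewrite integral_affine ?gt_eqF// gtr0_norm// muleA -EFinM exprS invfM.
by rewrite [X in X%:E]mulrC.
Qed.

(* [linear_integral l F (a, b)] is the integral of [F (a + |x|^2, b + l . x)]. *)
Fixpoint linear_integral (l : seq R) (F : R * R -> \bar R) (z : R * R) : \bar R :=
  if l is m :: l' then \int[mu]_x linear_integral l' F (z.1 + x ^+ 2, z.2 + m * x)%R
  else F z.

Lemma linear_integral_ge0 l F (z : R * R) : (forall w, 0 <= F w) -> 0 <= linear_integral l F z.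
Proof.
by move=> F0; elim: l z => [|m l IHl] z//=; apply: integral_ge0 => v _; exact: IHl.
Qed.

Lemma measurable_linear_integral l F : measurable_fun setT F -> (forall w, 0 <= F w) ->
  measurable_fun setT (linear_integral l F).
Proof.
move=> mF F0; elim: l => [|m l IHl] //=.
refine (measurable_integral (f := fun z : R * R * R => linear_integral l F
  (z.1.1 + z.2 ^+ 2, z.1.2 + m * z.2)%R) _ _); last first.
  by move=> z; exact: linear_integral_ge0.
apply: (measurableT_comp IHl); apply: measurable_fun_pair.
  by apply: measurable_funD; [exact: measurableT_comp|exact: measurable_funX].
by apply: measurable_funD; [exact: measurableT_comp|exact: measurable_funM].
Qed.

(** By induction the tail enters through e y for a single variable y, with e the norm of the tail; a
    rotation in the (x, y) plane merges m x + e y into one coordinate. *)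
Lemma linear_integral_rotation (m : R) l F (z : R * R) :
  measurable_fun setT F -> (forall w, 0 <= F w) ->
  linear_integral (m :: l) F z = \int[mu]_x radial_integral (size l)
    (fun s => F (s, z.2 + Num.sqrt (\sum_(i <- m :: l) i ^+ 2) * x)%R) (z.1 + x ^+ 2)%R.
Proof.
move=> mF F0; elim: l m z => [|m' l IHl] m [a b].
  rewrite big_seq1 sqrtr_sqr /=.
  pose f x := F (a + x ^+ 2, b + m * x)%R.
  have mf : measurable_fun setT f.
    apply: measurableT_comp => //; apply: measurable_fun_pair.
      exact: measurable_addsqr.
    by apply: measurable_funD => //; exact: measurable_funM.
  have [m0|m0] := ger0P m; first by [].
  transitivity (\int[mu]_x f (-1 * x + 0)%R).
    rewrite integral_affine ?oppr_eq0 ?oner_eq0//; last by move=> x; exact: F0.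
    by rewrite normrN1 invr1 mul1e.
  apply: eq_integral => x _; rewrite /f; congr (F (_, _)).
    by rewrite addr0 mulN1r sqrrN.
  by rewrite addr0 mulN1r mulrN mulNr.
rewrite [LHS]/=; set e := Num.sqrt (\sum_(i <- m' :: l) i ^+ 2).
pose K z := radial_integral (size l) (fun s => F (s, b + z.2)%R) (a + z.1)%R.
have mK : measurable_fun setT K.
  refine (measurable_radial_integral_param
    (G := fun z : R * R * R => F (z.2, b + z.1.2)%R) (size l) _ _ _).
  - apply: measurableT_comp => //; apply: measurable_fun_pair => //.
    by apply: measurable_funD => //; exact: measurableT_comp.
  - by move=> z; exact: F0.
  - by apply: measurable_funD.
have K0 z : 0 <= K z by exact: radial_integral_ge0.
transitivity (\int[mu]_x \int[mu]_y K (x ^+ 2 + y ^+ 2, m * x + e * y)%R).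
  apply: eq_integral => x _.
  have /= -> := IHl m' (a + x ^+ 2, b + m * x)%R.
  by apply: eq_integral => y _; rewrite /K/= !addrA.
rewrite integral_rotation//.
have -> : (m ^+ 2 + e ^+ 2 = \sum_(i <- [:: m, m' & l]) i ^+ 2)%R.
  by rewrite sqr_sqrtr 1?[RHS]big_cons//; apply: sumr_ge0 => i _; exact: sqr_ge0.
by apply: eq_integral => u _; apply: eq_integral => v _; rewrite /K/= addrA.
Qed.

End Radial.

(** * The Gamma function *)

Section GammaFunction.
Context {R : realType}.
Local Notation mu := (@lebesgue_measure R).

Lemma measurable_gamma_integrand (a : R) (D : set R) :
  measurable_fun D (fun t : R => t `^ (a - 1) * expR (- t)).
Proof.
apply: measurable_funTS; apply: measurable_funM; first exact: measurable_powR.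
by apply: measurableT_comp => //; exact: measurableT_comp.
Qed.

Lemma gamma_integrand_ge0 (a t : R) : 0 <= t `^ (a - 1) * expR (- t).
Proof. by rewrite mulr_ge0 ?powR_ge0 ?expR_ge0. Qed.

Lemma integral_powR_le (a e : R) : 0 < a -> 0 < e -> e < 1 ->
  (\int[mu]_(t in `[e, 1%R]) (t `^ (a - 1))%:E <= (a^-1)%:E)%E.
Proof.
move=> a0 e0 e1; pose F (t : R) := a^-1 * t `^ a.
have dF (t : R) : 0 < t -> is_derive t 1 F (t `^ (a - 1)).
  move=> t0; have := is_deriveZ a^-1 (is_derive1_powR a t0).
  by rewrite /GRing.scale/= mulrA mulVf ?mul1r// gt_eqF.
have cp (b t : R) : 0 < t -> {for t, continuous (fun x : R => x `^ b)}.
  by move=> t0; apply/differentiable_continuous/derivable1_diffP;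
    apply: derivable_powR; rewrite in_itv/= t0.
rewrite (@continuous_FTC2 _ _ F)//.
- by rewrite -EFinB lee_fin /F powR1 mulr1 gerBl mulr_ge0 ?invr_ge0 ?powR_ge0 ?ltW.
- apply: continuous_in_subspaceT => t; rewrite inE/= in_itv/= => /andP[et _].
  by apply: cp; exact: lt_le_trans et.
- split.
  + move=> t; rewrite in_itv/= => /andP[et _].
    by have [] := dF t (lt_trans e0 et).
  + apply: cvg_at_right_filter; apply: cvgM; first exact: cvg_cst.
    exact: cp.
  + apply: cvg_at_left_filter; apply: cvgM; first exact: cvg_cst.
    exact: cp.
- move=> t; rewrite in_itv/= => /andP[et _].
  by rewrite derive1E; have [_ ->] := dF t (lt_trans e0 et).
Qed.

(** The power may blow up at 0, so the interval is exhausted by [1/(n+2), 1], nondegenerate for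
    every n, where the antiderivative gives a bound free of n. *)
Lemma gamma_integral_lt1 (a : R) : 0 < a ->
  (\int[mu]_(t in `]0%R, 1%R]) (t `^ (a - 1) * expR (- t))%:E <= (a^-1)%:E)%E.
Proof.
move=> a0; pose A n : set R := `[n.+2%:R^-1, 1]%classic.
have -> : `]0%R, 1%R]%classic = \bigcup_n A n.
  apply/seteqP; split => t /=; rewrite in_itv/=.
    move=> /andP[t0 t1]; exists (Num.truncn t^-1) => //=.
    rewrite /A/= in_itv/= t1 andbT invf_ple ?posrE//.
    by rewrite (le_trans (ltW (truncnS_gt _)))// ler_nat.
  move=> [n _]; rewrite /A/= in_itv/= => /andP[nt ->]; rewrite andbT.
  by apply: lt_le_trans nt; rewrite invr_gt0.
have mf D : measurable_fun D (fun t : R => (t `^ (a - 1) * expR (- t))%:E).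
  by apply/measurable_EFinP; exact: measurable_gamma_integrand.
have ndA : nondecreasing_seq A.
  apply/nondecreasing_seqP => n; rewrite subsetEset => t; rewrite /A/= !in_itv/=.
  move=> /andP[nt ->]; rewrite andbT (le_trans _ nt)// lef_pV2 ?posrE//.
  by rewrite ler_nat.
have mA n : measurable (A n) by exact: measurable_itv.
have f0 n t : A n t -> (0 <= (t `^ (a - 1) * expR (- t))%:E)%E.
  by rewrite lee_fin gamma_integrand_ge0.
rewrite -(cvg_lim _ (@ge0_nondecreasing_set_cvg_integral _ (measurableTypeR R) R A
  _ mu ndA mA (fun n => mf (A n)) f0))//.
apply: lime_le.
  apply: ereal_nondecreasing_is_cvgn.
  exact: (@ge0_nondecreasing_set_nondecreasing_integral _ (measurableTypeR R) R A
    _ mu ndA mA (fun n => mf (A n)) f0).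
apply: nearW => n.
apply: le_trans (@integral_powR_le a (n.+2%:R^-1) a0 _ _); last 2 first.
- by rewrite invr_gt0.
- by rewrite invf_lt1 ?ltr1n.
apply: ge0_le_integral => //.
- exact: mA.
- exact: f0.
- exact: mf.
- by apply/measurable_EFinP/measurable_funTS; exact: measurable_powR.
move=> t; rewrite /A/= in_itv/= => /andP[nt _].
have t0 : 0 <= t by rewrite (le_trans _ nt).
by rewrite lee_fin ler_piMr ?powR_ge0// -[leRHS]expR0 ler_expR oppr_le0.
Qed.

Lemma powR_le_expR (a : R) : exists2 C : R, 0 < C &
  forall t, 1 <= t -> t `^ (a - 1) <= C * expR (t / 2).
Proof.
(* From ln u < u at u = t / (2m) follows m ln t <= t / 2 + m ln (2m), whence the constant. The added
   1 keeps m positive when a = 1. *)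
pose m := `|a - 1| + 1; have m0 : 0 < m by rewrite ltr_wpDl.
exists (expR (m * ln (2 * m))); first exact: expR_gt0.
move=> t t1; have t0 : 0 < t by exact: lt_le_trans t1.
rewrite /powR gt_eqF// -expRD ler_expR.
have lnt : 0 <= ln t by rewrite ln_ge0.
apply: (@le_trans _ _ (m * ln t)).
  apply: ler_wpM2r => //; apply: le_trans (ler_norm _) _.
  by rewrite /m lerDl.
have m2 : 0 < 2 * m by rewrite mulr_gt0.
have -> : ln t = ln (t / (2 * m)) + ln (2 * m).
  by rewrite -lnM ?posrE ?divr_gt0// divfK ?gt_eqF.
rewrite mulrDr addrC lerD2l.
apply: (@le_trans _ _ (m * (t / (2 * m)))).
  by rewrite ler_pM2l// ltW// ln_sublinear// divr_gt0.
by rewrite (_ : m * _ = t / 2)//; field; rewrite gt_eqF.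
Qed.

Lemma gamma_integral_gt1 (a : R) :
  (\int[mu]_(t in `]1%R, +oo[) (t `^ (a - 1) * expR (- t))%:E < +oo)%E.
Proof.
have [C C0 hC] := powR_le_expR a.
have e2 : 0 < 2^-1 :> R by rewrite invr_gt0.
(* The exponential density of rate 1/2 has total mass 1; the 2 in [2 * C] undoes its factor 1/2. *)
apply: (@le_lt_trans _ _ (\int[mu]_(t in `]1%R, +oo[)
    ((2 * C)%:E * (exponential_pdf 2^-1 t)%:E))%E).
  apply: ge0_le_integral => //.
  - by move=> t _; rewrite lee_fin gamma_integrand_ge0.
  - by apply/measurable_EFinP; exact: measurable_gamma_integrand.
  - apply/measurable_EFinP; apply: measurable_funM => //.
    by apply: measurable_funTS; exact: measurable_exponential_pdf.
  move=> t; rewrite /= in_itv/= andbT => t1.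
  rewrite -EFinM lee_fin exponential_pdfE; last by rewrite (le_trans _ (ltW t1)).
  rewrite mulrCA !mulrA mulVf// mul1r.
  apply: (@le_trans _ _ (C * expR (t / 2) * expR (- t))).
    by rewrite ler_pM2r ?expR_gt0// hC// ltW.
  rewrite -mulrA -expRD ler_pM2l// ler_expR.
  by rewrite mulNr (mulrC _ t); lra.
have mE : measurable_fun setT (fun t : R => (exponential_pdf 2^-1 t)%:E).
  by apply/measurable_EFinP; exact: measurable_exponential_pdf.
have E0 (t : R) : (0 <= (exponential_pdf 2^-1 t)%:E)%E.
  by rewrite lee_fin exponential_pdf_ge0// ltW.
rewrite ge0_integralZl//; last 2 first.
- exact: measurable_funTS.
- by rewrite lee_fin mulr_ge0// ltW.
apply: (@le_lt_trans _ _ ((2 * C)%:E * \int[mu]_t (exponential_pdf 2^-1 t)%:E)%E).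
  by rewrite lee_pmul2l ?lte_fin ?mulr_gt0// ge0_subset_integral.
by rewrite integral_exponential_pdf// mule1 ltry.
Qed.

Lemma integrable_gamma (a : R) : 0 < a ->
  mu.-integrable `]0, +oo[ (fun t : R => (t `^ (a - 1) * expR (- t))%:E).
Proof.
move=> a0; have mf D : measurable_fun D (fun t : R => (t `^ (a - 1) * expR (- t))%:E).
  by apply/measurable_EFinP; exact: measurable_gamma_integrand.
apply/integrableP; split; first exact: mf.
under eq_integral => t _ do rewrite gee0_abs ?lee_fin ?gamma_integrand_ge0//.
have -> : `]0, +oo[%classic = `]0, 1] `|` `]1, +oo[ :> set R.
  by rewrite -itv_bndbnd_setU// bnd_simp.
rewrite ge0_integral_setU//=.
- rewrite lte_add_pinfty ?gamma_integral_gt1//.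
  by rewrite (le_lt_trans (gamma_integral_lt1 a0)) ?ltry.
- exact: mf.
- by move=> t _; rewrite lee_fin gamma_integrand_ge0.
- apply/disj_setPS => t [] /=; rewrite !in_itv/= andbT => /andP[_ t1].
  by rewrite ltNge t1.
Qed.

Lemma Gamma_integral (a : R) : 0 < a ->
  (\int[mu]_(t in `]0%R, +oo[) (t `^ (a - 1) * expR (- t))%:E = (Gamma a)%:E)%E.
Proof.
by move=> a0; rewrite /Gamma /Rintegral fineK//; apply: integrable_fin_num => //;
  exact: integrable_gamma.
Qed.

Lemma Gamma_gt0 (a : R) : 0 < a -> 0 < Gamma a.
Proof.
move=> a0; rewrite -lte_fin -Gamma_integral//.
have mf D : measurable_fun D (fun t : R => (t `^ (a - 1) * expR (- t))%:E).
  by apply/measurable_EFinP; exact: measurable_gamma_integrand.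
(* A lower bound of the integrand on [1, 2], where 0 <= ln t <= 2 and t <= 2. *)
pose c := expR (- (`|a - 1| * 2) - 2).
apply: (@lt_le_trans _ _ (\int[mu]_(t in `[1%R, 2%R]) (cst c%:E t))%E).
  rewrite integral_cst//= lebesgue_measure_itv/= lte_fin ltr1n -EFinB -EFinM lte_fin.
  by rewrite mulr_gt0 ?expR_gt0//; lra.
apply: (@le_trans _ _ (\int[mu]_(t in `[1%R, 2%R]) (t `^ (a - 1) * expR (- t))%:E)%E).
  apply: ge0_le_integral => //.
  - by move=> t _; rewrite lee_fin expR_ge0.
  - exact: mf.
  - move=> t; rewrite /= in_itv/= => /andP[t1 t2].
    have t0 : 0 < t by exact: lt_le_trans t1.
    rewrite lee_fin /powR gt_eqF// -expRD ler_expR lerD ?lerN2//.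
    rewrite lerNl -mulNr; apply: (@le_trans _ _ (`|a - 1| * ln t)).
      by rewrite ler_wpM2r ?ln_ge0// -normrN ler_norm.
    rewrite ler_wpM2l// (le_trans (ltW (ln_sublinear t0)))//.
apply: ge0_subset_integral => //.
- exact: mf.
- by move=> t _; rewrite lee_fin gamma_integrand_ge0.
- by move=> t /=; rewrite !in_itv/= andbT => /andP[t1 _]; exact: lt_le_trans t1.
Qed.

(** Apply ln u < u to u = t^e, and to u = t^(-e) for the negative part. A logarithmic factor is thus
    absorbed by an arbitrarily small change of exponent. *)
Lemma ln_le_powR (e t : R) : 0 < e -> 0 < t -> `|ln t| <= e^-1 * (t `^ e + t `^ (- e)).
Proof.
move=> e0 t0.
have h (s : R) : 0 < s -> ln s <= e^-1 * s `^ e.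
  move=> s0; rewrite mulrC ler_pdivlMr// mulrC -ln_powR ltW// ln_sublinear//.
  exact: powR_gt0.
have p0 s : 0 <= e^-1 * t `^ s by rewrite mulr_ge0 ?powR_ge0// invr_ge0 ltW.
rewrite ler_norml mulrDr; apply/andP; split.
  have := h t^-1; rewrite invr_gt0 lnV ?posrE// -[in X in _ <= X](powR_inv1 (ltW t0)).
  by rewrite -powRrM mulN1r => /(_ t0) ?; have := p0 e; lra.
by have := h t t0; have := p0 (- e); lra.
Qed.

Lemma powR_le_sum (u v b t : R) : 0 < t -> u <= b -> b <= v ->
  t `^ b <= t `^ u + t `^ v.
Proof.
move=> t0 ub bv; have [t1|t1] := leP t 1.
  by rewrite ler_wpDr ?powR_ge0// ger_powR// t0.
by rewrite ler_wpDl ?powR_ge0// ler_powR// ltW.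
Qed.

Lemma derivable_Gamma (a : R) : 0 < a -> derivable Gamma a 1.
Proof.
move=> a0.
pose f (b t : R) := t `^ (b - 1) * expR (- t).
have df (b t : R) : 0 < t -> is_derive b 1 (f ^~ t) (ln t * t `^ (b - 1) * expR (- t)).
  move=> t0; rewrite /f (_ : (fun b => _) = (fun b => expR ((b - 1) * ln t) * expR (- t))).
    by apply: is_derive_eq; rewrite /GRing.scale/= /powR gt_eqF//; ring.
  by apply/funext => x; rewrite /powR gt_eqF.
(* The smallest of the four exponents below is u - e = a / 4, still positive, so all four Gamma
   integrals converge. *)
pose e := a / 4; pose u := a / 2; pose v := 2 * a.
have e0 : 0 < e by rewrite divr_gt0.
(* Dominates the derivative on ]u, v[, by [ln_le_powR] and [powR_le_sum]. *)
pose G (t : R) : R := e^-1 * (f (u + e) t + f (u - e) t + f (v + e) t + f (v - e) t).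
have f0 b t : 0 <= f b t by exact: gamma_integrand_ge0.
apply: (@derivable_under_integral R _ _ mu f `]0, +oo[%classic _ a u v _ _ _ G) => //.
- by rewrite /= in_itv/= /u /v; apply/andP; split; lra.
- move=> b; rewrite /= in_itv/= => /andP[ub _]; apply: integrable_gamma.
  by apply: lt_trans ub; rewrite divr_gt0.
- by move=> b t _; rewrite /= in_itv/= andbT => t0; have [] := df b t t0.
- by move=> t; rewrite /G mulr_ge0 ?addr_ge0// invr_ge0 ltW.
- have ig b : 0 < b -> mu.-integrable `]0, +oo[ (EFin \o f b) by exact: integrable_gamma.
  rewrite (_ : EFin \o G = fun t => (e^-1)%:E * (((EFin \o f (u + e)%R) \+
    (EFin \o f (u - e)%R) \+ (EFin \o f (v + e)%R) \+ (EFin \o f (v - e)%R)) t))%E//.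
  apply: integrableZl => //.
  by do 3 (apply: integrableD => //; last by apply: ig; rewrite /u /v /e; lra);
    apply: ig; rewrite /u /v /e; lra.
move=> b t; rewrite /= !in_itv/= andbT => /andP[ub bv] t0.
rewrite /partial1of2 derive1E; have [_ ->] := df b t t0.
rewrite !normrM (ger0_norm (powR_ge0 _ _)) (ger0_norm (expR_ge0 _)).
apply: (@le_trans _ _ (e^-1 * (t `^ e + t `^ (- e)) *
   (t `^ (u - 1) + t `^ (v - 1)) * expR (- t))).
  rewrite ler_pM2r ?expR_gt0// ler_pM ?powR_ge0//; first exact: ln_le_powR.
  by apply: powR_le_sum => //; lra.
have tn0 : t != 0 by rewrite gt_eqF.
have pD r s : t `^ (r + s - 1) = t `^ (r - 1) * t `^ s.
  by rewrite -powRD ?tn0 ?implybT//; congr (_ `^ _); ring.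
by rewrite /G /f !pD; lra.
Qed.

End GammaFunction.

(** * Moments of the stereographic density *)

Section Stereo.
Context {R : realType}.
Local Notation mu := (@lebesgue_measure R).

Lemma integral_gauss_scaled (t : R) : 0 < t ->
  (\int[mu]_v (expR (- (t * v ^+ 2)))%:E = (Num.sqrt (pi / t))%:E)%E.
Proof.
move=> t0; have st0 : 0 < Num.sqrt t by rewrite sqrtr_gt0.
transitivity (\int[mu]_v (gauss_fun (Num.sqrt t * v + 0))%:E)%E.
  by apply: eq_integral => v _; rewrite /gauss_fun addr0 exprMn sqr_sqrtr// ltW.
rewrite (@integral_affine _ _ 0 (fun v => (gauss_fun v)%:E)) ?gt_eqF//.
- by rewrite integralT_gauss gtr0_norm// -EFinM mulrC sqrtrM ?pi_ge0// sqrtrV// ltW.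
- by apply/measurable_EFinP; exact: measurable_gauss_fun.
- by move=> v; rewrite lee_fin gauss_fun_ge0.
Qed.

Lemma radial_integral_gauss n (t a : R) : 0 < t ->
  radial_integral n (fun s => (expR (- (t * s)))%:E) a =
  (expR (- (t * a)) * Num.sqrt (pi / t) ^+ n)%:E.
Proof.
move=> t0; elim: n a => [|n IHn] a /=; first by rewrite expr0 mulr1.
transitivity (\int[mu]_v ((expR (- (t * a)) * Num.sqrt (pi / t) ^+ n)%:E *
    (expR (- (t * v ^+ 2)))%:E))%E.
  apply: eq_integral => v _; rewrite IHn -EFinM; congr EFin.
  by rewrite mulrDr opprD expRD mulrAC.
rewrite ge0_integralZl//.
- by rewrite integral_gauss_scaled// -EFinM exprSr mulrA.
- apply/measurable_EFinP; apply: measurableT_comp => //; apply: measurableT_comp => //.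
  by apply: measurable_funM => //; exact: measurable_funX.
Qed.

(** The Gamma integrand extended by 0, so that Tonelli can be used on the whole line. *)
Definition gamma_kernel (a c t : R) : R :=
  if 0 < t then t `^ (a - 1) * expR (- (c * t)) else 0.

Lemma gamma_kernel_ge0 a c t : 0 <= gamma_kernel a c t.
Proof. by rewrite /gamma_kernel; case: ifP => // _; rewrite mulr_ge0 ?powR_ge0 ?expR_ge0. Qed.

Lemma measurable_gamma_kernel d (T : measurableType d) a (c t : T -> R) :
  measurable_fun setT c -> measurable_fun setT t ->
  measurable_fun setT (fun x => gamma_kernel a (c x) (t x)).
Proof.
move=> mc mt; apply: measurable_fun_ifT => //.
  by apply: measurable_fun_ltr.
apply: measurable_funM; first exact: (measurableT_comp (measurable_powR (a - 1))).
apply: measurableT_comp => //; apply: measurableT_comp => //.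
exact: measurable_funM.
Qed.

Lemma integral_gamma_kernel (a c : R) : 0 < a -> 0 < c ->
  (\int[mu]_t (gamma_kernel a c t)%:E = (Gamma a * c `^ (- a))%:E)%E.
Proof.
move=> a0 c0; have cn0 : c != 0 by rewrite gt_eqF.
transitivity (\int[mu]_t ((c `^ (1 - a))%:E * (gamma_kernel a 1 (c * t + 0))%:E))%E.
  apply: eq_integral => t _; rewrite -EFinM; congr EFin.
  rewrite /gamma_kernel addr0 pmulr_rgt0// mul1r; case: ifPn => t0; last by rewrite mulr0.
  rewrite powRM ?(ltW c0) ?(ltW t0)// !mulrA -powRD ?cn0 ?implybT//.
  by rewrite (_ : 1 - a + (a - 1) = 0) ?powRr0 ?mul1r//; ring.
have mk : measurable_fun setT (fun t => (gamma_kernel a 1 t)%:E).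
  by apply/measurable_EFinP; exact: measurable_gamma_kernel.
have k0 (x : R) : (0 <= (gamma_kernel a 1 x)%:E)%E by rewrite lee_fin gamma_kernel_ge0.
rewrite ge0_integralZl//; last 2 first.
- apply/measurable_EFinP; apply: measurable_gamma_kernel => //.
  by apply: measurable_funD => //; exact: measurable_funM.
- by rewrite lee_fin powR_ge0.
rewrite (@integral_affine _ _ 0 (fun t => (gamma_kernel a 1 t)%:E)) ?gt_eqF//.
have -> : (\int[mu]_t (gamma_kernel a 1 t)%:E = (Gamma a)%:E)%E.
  rewrite -Gamma_integral// [RHS]integral_mkcond; apply: eq_integral => t _.
  rewrite patchE /gamma_kernel mul1r mem_setE in_itv/= andbT.
  by case: ifP.
rewrite -!EFinM gtr0_norm// mulrA (mulrC (Gamma a)); congr (_ * _)%:E.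
rewrite -powR_inv1 ?(ltW c0)// -powRD ?cn0 ?implybT//.
by congr (_ `^ _); ring.
Qed.

(** The Gaussian integral contributes (pi / t)^(n/2), which lowers the exponent a of the Gamma
    integral to a - n/2; the hypothesis keeps the latter positive. *)
Lemma radial_integral_powR n (a : R) : n%:R / 2 < a ->
  radial_integral n (fun s => ((1 + s) `^ (- a))%:E) 0 =
  (pi `^ (n%:R / 2) * (Gamma (a - n%:R / 2) / Gamma a))%:E.
Proof.
move=> na; have a0 : 0 < a by rewrite (le_lt_trans _ na)// divr_ge0.
have G0 := Gamma_gt0 a0.
have mp : measurable_fun setT (fun s : R => ((1 + s) `^ (- a))%:E).
  apply/measurable_EFinP; apply: (measurableT_comp (measurable_powR (- a))).
  exact: measurable_funD.
suff H : ((Gamma a)%:E * radial_integral n (fun s => ((1 + s) `^ (- a))%:E) 0 =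
    (pi `^ (n%:R / 2) * Gamma (a - n%:R / 2))%:E)%E.
  rewrite mulrA EFinM -H muleC muleA -EFinM mulVf ?mul1e// gt_eqF//.
rewrite -radial_integralZl ?(ltW G0)//; last by move=> s; rewrite lee_fin powR_ge0.
pose f (z : R * R) := (gamma_kernel a (1 + z.2) z.1)%:E.
have mf : measurable_fun setT f.
  apply/measurable_EFinP; apply: measurable_gamma_kernel => //.
  by apply: measurable_funD.
have f0 z : (0 <= f z)%E by rewrite lee_fin gamma_kernel_ge0.
transitivity (radial_integral n (fun s => \int[mu]_t f (t, s))%E 0).
  apply: eq_radial_integral => s s0; rewrite -EFinM.
  have s1 : 0 < 1 + s by rewrite ltr_wpDr.
  exact/esym/(integral_gamma_kernel a0 s1).
rewrite -radial_integral_tonelli//.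
transitivity (\int[mu]_t ((pi `^ (n%:R / 2))%:E *
    (gamma_kernel (a - n%:R / 2) 1 t)%:E))%E.
  apply: eq_integral => t _.
  have [t0|t0] := ltP 0 t; last first.
    rewrite [in RHS]/gamma_kernel ltNge t0/= mule0.
    (* 0 is written as 0 times an integral, so that homogeneity brings it under the integral
       sign. *)
    rewrite -[RHS](mul0e (radial_integral n (fun _ => 1%E) 0)) -radial_integralZl//.
    apply: eq_radial_integral => s s0.
    by rewrite /f /gamma_kernel ltNge t0/= mul0e.
  transitivity (radial_integral n (fun s =>
      (t `^ (a - 1) * expR (- t))%:E * (expR (- (t * s)))%:E)%E 0).
    apply: eq_radial_integral => s s0; rewrite /f /gamma_kernel t0 -EFinM.
    by rewrite mulrDl mul1r opprD expRD mulrA (mulrC s).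
  rewrite radial_integralZl//; last 2 first.
  - have mt : measurable_fun setT (fun s : R => - ((t : R) * s)).
      apply: measurable_funN. exact: (@mulrl_measurable R setT t).
    apply/measurable_EFinP; exact: (measurableT_comp (@measurable_expR R) mt).
  - by rewrite mulr_ge0 ?powR_ge0 ?expR_ge0.
  rewrite radial_integral_gauss// mulr0 oppr0 expR0 mul1r -!EFinM; congr EFin.
  rewrite /gamma_kernel t0 mul1r.
  have -> : Num.sqrt (pi / t) ^+ n = pi `^ (n%:R / 2) * t `^ (- (n%:R / 2)).
    have pt0 : 0 < pi / t :> R by rewrite divr_gt0// pi_gt0.
    rewrite -powR12_sqrt ?(ltW pt0)// -powR_mulrn ?powR_ge0// -powRrM mulrC.
    rewrite powRM ?pi_ge0 ?invr_ge0 ?(ltW t0)// -(powR_inv1 (ltW t0)) -powRrM.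
    by rewrite mulN1r [RHS]mulrC (mulrC n%:R).
  have -> : a - n%:R / 2 - 1 = (a - 1) + (- (n%:R / 2)) by ring.
  by rewrite (powRD (r := a - 1)) ?(gt_eqF t0) ?implybT//; ring.
rewrite ge0_integralZl//; last 3 first.
- by apply/measurable_EFinP; exact: measurable_gamma_kernel.
- by move=> t _; rewrite lee_fin gamma_kernel_ge0.
- by rewrite lee_fin powR_ge0.
rewrite integral_gamma_kernel ?subr_gt0//.
by rewrite powR1 mulr1 -EFinM.
Qed.

End Stereo.

(** * Logarithmic moment *)

Section LogMoment.
Context {R : realType}.

Lemma is_derive_Gamma (a : R) : 0 < a -> is_derive a 1 Gamma (Gamma a * digamma a).
Proof.
move=> a0; have G0 := Gamma_gt0 a0.
have dG : is_derive a 1 (Gamma : R -> R) ('D_1 Gamma a).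
  by apply: DeriveDef => //; exact: derivable_Gamma.
suff -> : Gamma a * digamma a = 'D_1 Gamma a by [].
have dl := is_derive1_ln G0.
have := is_derive1_comp dl dG.
rewrite /digamma derive1E => -[_ ->].
by rewrite mulrA mulfV ?mul1r// gt_eqF.
Qed.

(* The integral of [(1 + |z|^2)^(-a)] over R^(2b). *)
Definition power_moment (b a : R) : R := pi `^ b * (Gamma (a - b) / Gamma a).

Lemma power_moment_gt0 (b a : R) : 0 < b -> b < a -> 0 < power_moment b a.
Proof.
move=> b0 ba; rewrite /power_moment mulr_gt0 ?powR_gt0 ?pi_gt0//.
rewrite divr_gt0 ?Gamma_gt0 ?subr_gt0//.
exact: lt_trans ba.
Qed.

Lemma is_derive_power_moment (b a : R) : 0 < b -> b < a ->
  is_derive a 1 (power_moment b) (power_moment b a * (digamma (a - b) - digamma a)).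
Proof.
move=> b0 ba; have a0 : 0 < a by exact: lt_trans ba.
have ab0 : 0 < a - b by rewrite subr_gt0.
have dG := is_derive_Gamma a0.
have ds : is_derive a 1 (fun x : R => x - b) 1.
  by apply: is_derive_eq; rewrite subr0.
have dGb := @is_derive1_comp _ Gamma (fun x => x - b) a _ _ (is_derive_Gamma ab0) ds.
have G0 : Gamma a != 0 by rewrite gt_eqF// Gamma_gt0.
have dV := is_deriveV G0 dG.
have dW : is_derive a 1 (power_moment b) _ := is_deriveZ (pi `^ b) (is_deriveM dGb dV).
apply: (is_derive_eq dW).
rewrite /power_moment /GRing.scale /=.
move: (Gamma a) (Gamma (a - b)) (digamma a) (digamma (a - b)) (pi `^ b) G0.
by move=> A B x y p A0; field.
Qed.

(** f x + l x has a minimum at the interior point a, so its derivative vanishes there. *)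
Lemma supporting_line_derive (f : R -> R) (a c l : R) : c < a ->
  (forall x, c < x -> derivable f x 1) ->
  (forall x, c < x -> f a - l * (x - a) <= f x) -> 'D_1 f a = - l.
Proof.
move=> ca df fl; pose g x := f x + l * x.
have dg x : c < x -> is_derive x 1 g ('D_1 f x + l).
  move=> cx; have dfx : is_derive x 1 f ('D_1 f x) by apply: DeriveDef => //; exact: df.
  have H : is_derive x 1 g _ := is_deriveD dfx (is_deriveZ l (is_derive_id x 1)).
  by apply: (is_derive_eq H); rewrite /GRing.scale/= mulr1.
have aI : a \in `]c, a + 1[%R by rewrite in_itv/= ca ltrDl ltr01.
have ca1 : c <= a + 1 by rewrite ltW// (lt_trans ca)// ltrDl.
have dgI t : t \in `]c, (a + 1)[%R -> derivable g t 1.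
  by rewrite in_itv/= => /andP[ct _]; have [] := dg t ct.
have [|_] := @derive1_at_min R g c (a + 1) a ca1 dgI aI.
  by move=> t; rewrite in_itv/= => /andP[ct _]; rewrite /g; have := fl t ct; lra.
by have [_ ->] := dg a ca; move: ('D_1 f a) => x; lra.
Qed.

Lemma radial_integral_powR_ln n (a : R) : n%:R / 2 < a -> (0 < n)%N ->
  radial_integral n (fun s => ((1 + s) `^ (- a) * ln (1 + s))%:E) 0 =
  (power_moment (n%:R / 2) a * (digamma a - digamma (a - n%:R / 2)))%:E.
Proof.
move=> na n0; set b := n%:R / 2; pose V := power_moment b.
have b0 : 0 < b by rewrite divr_gt0// ltr0n.
pose p c (s : R) := (1 + s) `^ (- c).
have mp c : measurable_fun setT (fun s => (p c s)%:E).
  apply/measurable_EFinP; apply: (measurableT_comp (measurable_powR (- c))).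
  exact: measurable_funD.
have p0 c s : (0 <= (p c s)%:E)%E by rewrite lee_fin powR_ge0.
(* The absolute value makes [q] nonnegative on the whole line; for s >= 0, the only arguments
   integrated over, it changes nothing. *)
pose q (s : R) := p a s * `|ln (1 + s)|.
have mq : measurable_fun setT (fun s => (q s)%:E).
  apply/measurable_EFinP; apply: measurable_funM.
    by apply/measurable_EFinP; exact: mp.
  apply: measurableT_comp => //; apply: (measurableT_comp (@measurable_ln R)).
  exact: measurable_funD.
have q0 s : (0 <= (q s)%:E)%E by rewrite lee_fin mulr_ge0 ?powR_ge0.
have -> : radial_integral n (fun s => ((1 + s) `^ (- a) * ln (1 + s))%:E) 0 =
    radial_integral n (fun s => (q s)%:E) 0.
  apply: eq_radial_integral => s s0; rewrite /q /p ger0_norm//.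
  by rewrite ln_ge0// lerDl.
have pV c : b < c -> radial_integral n (fun s => (p c s)%:E) 0 = (V c)%:E.
  by move=> bc; rewrite radial_integral_powR.
have tangent h s : 0 <= s -> p a s <= p (a + h) s + h * q s.
  move=> s0; have s1 : 0 < 1 + s by rewrite ltr_wpDr.
  rewrite /q ger0_norm ?ln_ge0 ?lerDl// /p opprD powRD ?(gt_eqF s1) ?implybT//.
  have : 1 - h * ln (1 + s) <= (1 + s) `^ (- h).
    by rewrite [leRHS]/powR gt_eqF// mulNr expR_ge1Dx.
  have P0 : 0 <= (1 + s) `^ (- a) by exact: powR_ge0.
  by move=> /(ler_wpM2l P0); lra.
set L := radial_integral n (fun s => (q s)%:E) 0.
have L0 : (0 <= L)%E by exact: radial_integral_ge0.
have mhq (h : R) : measurable_fun setT (fun s => h%:E * (q s)%:E)%E.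
  exact: measurable_funeM.
have hq0 (h : R) : 0 < h -> forall s, (0 <= h%:E * (q s)%:E)%E.
  by move=> h0 s; rewrite mule_ge0// lee_fin ltW.
have sumE (c h : R) : 0 < h -> b < c -> ((V c)%:E + h%:E * L)%E =
    radial_integral n (fun s => (p c s)%:E + h%:E * (q s)%:E)%E 0.
  move=> h0 bc; rewrite radial_integralD//; last exact: hq0.
  by rewrite pV// radial_integralZl// ltW.
have msum (c h : R) : measurable_fun setT (fun s => (p c s)%:E + h%:E * (q s)%:E)%E.
  exact: emeasurable_funD.
have sum0 (c h : R) : 0 < h -> forall s, (0 <= (p c s)%:E + h%:E * (q s)%:E)%E.
  by move=> h0 s; rewrite adde_ge0// hq0.
(* [tangent] at - h, and below at h: the two signs are kept apart because extended integrals are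
   scaled by nonnegative constants only. *)
have upper (h : R) : 0 < h -> b < a - h -> ((V a)%:E + h%:E * L <= (V (a - h)%R)%:E)%E.
  move=> h0 ah; rewrite sumE// -(pV (a - h))//.
  apply: (le_radial_integral _ (msum a h) (mp (a - h)) (sum0 a h h0) (p0 (a - h))) => s s0.
  by rewrite -EFinM -EFinD lee_fin; have := tangent (- h) s s0; lra.
have lower (h : R) : 0 < h -> ((V a)%:E <= (V (a + h)%R)%:E + h%:E * L)%E.
  move=> h0; have ah : b < a + h by rewrite ltr_wpDr// ltW.
  rewrite sumE// -(pV a)//.
  apply: (le_radial_integral _ (mp a) (msum _ h) (p0 a) (sum0 _ h h0)) => s s0.
  by rewrite -EFinM -EFinD lee_fin; exact: tangent.
(* Finiteness comes from the same inequality: a - h is the midpoint of b and a, so a finite moment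
   bounds h * L. *)
have Lfin : L \is a fin_num.
  rewrite ge0_fin_numE//; pose h := (a - b) / 2.
  have h0 : 0 < h by rewrite divr_gt0// subr_gt0.
  have up : ((V a)%:E + h%:E * L <= (V (a - h)%R)%:E)%E.
    by apply: upper => //; move: na; rewrite -/b /h; lra.
  rewrite ltey; apply/eqP => Ly; move: up; rewrite Ly.
  by rewrite gt0_muley ?lte_fin// addey.
pose l := fine L; have lE : L = l%:E by rewrite fineK.
have dV x : b < x -> derivable V x 1.
  by move=> bx; have [] := is_derive_power_moment b0 bx.
have : 'D_1 V a = - l.
  apply: (supporting_line_derive na dV) => x bx.
  have [xa|ax|->] := ltgtP x a.
  - have := upper (a - x); rewrite subr_gt0 xa (_ : a - (a - x) = x); last by ring.
    move=> /(_ isT bx); rewrite lE -EFinM -EFinD lee_fin.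
    by move: (V a) (V x) => y z; lra.
  - have := lower (x - a); rewrite subr_gt0 ax (_ : a + (x - a) = x); last by ring.
    move=> /(_ isT); rewrite lE -EFinM -EFinD lee_fin.
    by move: (V a) (V x) => y z; lra.
  - by rewrite subrr mulr0 subr0.
have [_ ->] := is_derive_power_moment b0 na.
by move=> VE; rewrite lE; congr EFin; rewrite -[l]opprK -VE -mulrN opprB.
Qed.

End LogMoment.

(** * Signed iterated integrals *)

Section IteratedIntegral.
Context {R : realType}.
Local Notation mu := (@lebesgue_measure R).

Lemma dotv_cons n (p x : R) (m t : n.-tuple R) :
  dotv [tuple of p :: m] (cons_tuple x t) = p * x + dotv m t.
Proof.
rewrite /dotv big_ord_recl !(tnth_nth 0)/=; congr (_ + _).
by apply: eq_bigr => i _; rewrite !(tnth_nth 0).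
Qed.

(** The first argument stands for |x|^2: the integrand is bounded and lives on the unit ball, so
    every partial iterated integral is finite. *)
Definition bounded_slab (M : R) (F : R * R -> R) :=
  [/\ measurable_fun setT F, forall z, 0 <= F z, forall z, F z <= M &
      forall z, 1 < z.1 -> F z = 0].

(** Each variable is confined to [-1, 1] and costs a factor 2. The indicator of z.1 <= 1 stays in
    the bound because it is what confines the next variable in the induction. *)
Lemma linear_integral_bound (M : R) F l (z : R * R) : bounded_slab M F -> 0 <= z.1 ->
  (linear_integral l (EFin \o F) z <=
   (M * 2 ^+ size l * (z.1 <= 1)%R%:R)%:E)%E.
Proof.
move=> [mF F0 FM Fs]; have mF' : measurable_fun setT (EFin \o F) by exact/measurable_EFinP.
have M0 : 0 <= M by apply: le_trans (FM (0, 0)).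
elim: l z => [|m l IHl] [a b] /= a0.
  rewrite lee_fin expr0 mulr1; have [a1|a1] := leP a 1; first by rewrite mulr1 FM.
  by rewrite mulr0 Fs.
have mL : measurable_fun setT
    (fun x : R => linear_integral l (EFin \o F) (a + x ^+ 2, b + m * x)).
  apply: measurableT_comp; first by apply: measurable_linear_integral => // w; exact: F0.
  apply: measurable_fun_pair; first exact: measurable_addsqr.
  by apply: measurable_funD => //; exact: measurable_funM.
apply: (@le_trans _ _ (\int[mu]_x ((M * 2 ^+ size l * (a <= 1)%R%:R)%:E *
    (\1_(`[-1, 1]%classic : set R) x)%:E))%E).
  apply: ge0_le_integral => //.
  - by move=> x _; apply: linear_integral_ge0 => w; exact: F0.
  - by apply/measurable_EFinP; apply: measurable_funM => //; exact: measurable_indic.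
  move=> x _; have x20 := sqr_ge0 x.
  apply: (le_trans (IHl _ _)) => /=; first by rewrite addr_ge0.
  rewrite -EFinM lee_fin -[leRHS]mulrA ler_wpM2l ?mulr_ge0 ?exprn_ge0//.
  have [ax|ax] := leP (a + x ^+ 2) 1; last by rewrite mulr_ge0.
  have x1 : `|x| <= 1.
    by rewrite -(@ler_pXn2r _ 2) ?nnegrE// expr1n real_normK ?num_real//; lra.
  rewrite indicE mem_set; last by rewrite /= in_itv/= -ler_norml.
  by rewrite (_ : a <= 1) ?mulr1//; lra.
rewrite ge0_integralZl//; last 2 first.
- by apply/measurable_EFinP; exact: measurable_indic.
- by rewrite lee_fin !mulr_ge0 ?exprn_ge0.
rewrite integral_indic//= setIT lebesgue_measure_itv/= lte_fin ifT; last by lra.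
by rewrite -EFinB -EFinM lee_fin exprSr; case: (a <= 1); lra.
Qed.

Lemma linear_integral_fin_num (M : R) F l (z : R * R) : bounded_slab M F -> 0 <= z.1 ->
  linear_integral l (EFin \o F) z \is a fin_num.
Proof.
move=> sF z0; have [_ F0 _ _] := sF; rewrite ge0_fin_numE.
  by rewrite (le_lt_trans (linear_integral_bound l sF z0))// ltry.
by apply: linear_integral_ge0 => w; exact: F0.
Qed.

(** The passage from signed real integrals to nonnegative extended ones. Linearity is applied at
    every level of the iteration, each inner integral being finite by the slab bound. *)
Lemma lebesgue_int_linear n (m : n.-tuple R) (M : R) (F G : R * R -> R) (a b A B : R) :
  bounded_slab M F -> bounded_slab M G -> 0 <= a ->
  lebesgue_int (fun x : n.-tuple R => A * F (a + dotv x x, b + dotv m x) +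
                                      B * G (a + dotv x x, b + dotv m x)) =
  A * fine (linear_integral m (EFin \o F) (a, b)) +
  B * fine (linear_integral m (EFin \o G) (a, b)).
Proof.
move=> sF sG; elim: n m a b => [|n IHn] m a b a0.
  by rewrite tuple0 /= /dotv !big_ord0 !addr0.
case/tupleP: m => p m /=.
pose g (H : R * R -> R) (x : R) : R :=
  fine (linear_integral m (EFin \o H) (a + x ^+ 2, b + p * x)).
have gE H : bounded_slab M H ->
    EFin \o g H = fun x : R => linear_integral m (EFin \o H) (a + x ^+ 2, b + p * x).
  move=> sH; apply/funext => x; rewrite /= /g fineK//.
  by apply: (linear_integral_fin_num _ sH); rewrite addr_ge0// sqr_ge0.
have ig H : bounded_slab M H -> mu.-integrable setT (EFin \o g H).
  move=> sH; have [mH H0 _ _] := sH.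
  have L0 z : (0 <= linear_integral m (EFin \o H) z)%E.
    by apply: linear_integral_ge0 => w; exact: H0.
  apply/integrableP; rewrite gE//; split.
    apply: measurableT_comp.
      by apply: measurable_linear_integral => [|w]; [exact/measurable_EFinP|exact: H0].
    apply: measurable_fun_pair; first exact: measurable_addsqr.
    by apply: measurable_funD => //; exact: measurable_funM.
  under eq_integral => x _ do rewrite gee0_abs//.
  have := linear_integral_bound (p :: m) sH (z := (a, b)) a0 => /=.
  by move=> /le_lt_trans; apply; rewrite ltry.
transitivity (\int[mu]_x (A * g F x + B * g G x)).
  rewrite /g; apply: eq_Rintegral => x _.
  rewrite -IHn ?addr_ge0 ?sqr_ge0//; congr lebesgue_int; apply/funext => t.
  have -> : dotv (cons_tuple x t) (cons_tuple x t) = x ^+ 2 + dotv t t.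
    by have := dotv_cons x x t t; rewrite expr2 => <-; congr dotv; apply: val_inj.
  by rewrite dotv_cons !addrA.
have igF := ig _ sF; have igG := ig _ sG.
rewrite RintegralD//; last 2 first.
- by have := integrableZl measurableT A igF.
- by have := integrableZl measurableT B igG.
rewrite !RintegralZl// /Rintegral.
have EF H : (fun x => (g H x)%:E) = EFin \o g H by [].
by rewrite !EF !gE.
Qed.

End IteratedIntegral.

(** * Stereographic substitution *)

Section Stereographic.
Context {R : realType}.
Local Notation mu := (@lebesgue_measure R).
Implicit Types (s p x : R).

(* The inverse of [x |-> x + sqrt (x^2 + s)]. *)
Definition stereo s p : R := (p - s / p) / 2.

Lemma is_derive_stereo s p : p != 0 -> is_derive p 1 (stereo s) ((1 + s / p ^+ 2) / 2).
Proof.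
move=> p0; have dV := is_deriveV p0 (is_derive_id p 1).
have H : is_derive p 1 (fun x : R => 2^-1 *: (x - s *: x^-1)) _ :=
  is_deriveZ 2^-1 (is_deriveB (is_derive_id p 1) (is_deriveZ s dV)).
have -> : stereo s = (fun x : R => 2^-1 *: (x - s *: x^-1)).
  by apply/funext => x; rewrite /stereo /GRing.scale/= mulrC.
by apply: (is_derive_eq H); rewrite /GRing.scale/=; field.
Qed.

Lemma continuous_stereo s p : p != 0 -> {for p, continuous (stereo s)}.
Proof.
move=> p0; apply/differentiable_continuous/derivable1_diffP.
by have [] := is_derive_stereo s p0.
Qed.

Lemma continuous_derive1_stereo s p : 0 < p -> {for p, continuous (derive1 (stereo s))}.
Proof.
move=> p0; have E q : 0 < q -> (1 + s / q ^+ 2) / 2 = (derive1 (stereo s)) q.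
  by move=> q0; rewrite derive1E; have [_ ->] := is_derive_stereo s (lt0r_neq0 q0).
rewrite /prop_for /continuous_at -E//.
apply: (@cvg_trans _ ((fun q : R => (1 + s / q ^+ 2) / 2) @ p)).
  apply: near_eq_cvg; near=> q; apply: E; near: q; exact: lt_nbhsr.
suff : {for p, continuous (fun q : R => (1 + s / q ^+ 2) / 2)} by [].
apply/differentiable_continuous/derivable1_diffP.
apply: derivableM; last exact: derivable_cst.
apply: derivableD; first exact: derivable_cst.
apply: derivableM; first exact: derivable_cst.
apply: derivableV; first by rewrite expf_neq0// gt_eqF.
exact: exprn_derivable.
Unshelve. all: by end_near. Qed.

(** The purpose of the coordinate: the squared radius is a perfect square, so the radius is rational
    in p. *)
Lemma stereo_sqr s p : p != 0 -> stereo s p ^+ 2 + s = ((p + s / p) / 2) ^+ 2.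
Proof. by move=> p0; rewrite /stereo; field. Qed.

Lemma sqrt_stereo s p : 0 < p -> 0 <= s ->
  Num.sqrt (stereo s p ^+ 2 + s) = (p + s / p) / 2.
Proof.
move=> p0 s0; rewrite stereo_sqr ?gt_eqF// sqrtr_sqr ger0_norm// divr_ge0//.
by rewrite addr_ge0 ?divr_ge0// ltW.
Qed.

(* The integrand of [sphere_integral] for [g (mu . x)], as a function of
   [(|x|^2, mu . x)]. *)
Definition cone_fun (g : R -> R) (z : R * R) : R :=
  if (0 < Num.sqrt z.1) && (Num.sqrt z.1 <= 1) then g (z.2 / Num.sqrt z.1) else 0.

(* [cone_fun] in stereographic coordinates, [t = |z|^2], with its Jacobian. *)
Definition stereo_cone (g : R -> R) (p t : R) : R :=
  if (0 < p) && (p * (1 + t) <= 2) then g ((1 - t) / (1 + t)) * ((1 + t) / 2) else 0.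

(** As s > 0, the argument x / sqrt (x^2 + s) stays strictly between -1 and 1, where [g] is
    continuous; the clipped functions used later can jump at 1. *)
Lemma integral_stereo (g : R -> R) s : 0 < s ->
  (forall t, -1 < t < 1 -> {for t, continuous g}) ->
  (\int[mu]_x (cone_fun g ((x ^+ 2 + s)%R, x))%:E =
   \int[mu]_p (stereo_cone g p (p^-1 ^+ 2 * s))%:E)%E.
Proof.
(* For s > 1 both supports are empty: they require x^2 + s <= 1 and p^2 + s <= 2 p. *)
move=> s0 cg; have [s1|s1] := ltP 1 s.
  rewrite !integral0_eq// => [p _|x _]; congr EFin.
    rewrite /stereo_cone; case: ifPn => // /andP[p0 ps].
    have : p * 2 < p * (p * (1 + p^-1 ^+ 2 * s)).
      rewrite (_ : p * (p * (1 + p^-1 ^+ 2 * s)) = p ^+ 2 + s); last by field; rewrite gt_eqF.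
      by have := sqr_ge0 (p - 1); rewrite sqrrB; lra.
    by rewrite ltr_pM2l// ltNge ps.
  rewrite /cone_fun/=; case: ifPn => // /andP[_].
  rewrite -[leRHS]sqrtr1 ler_psqrt ?nnegrE ?addr_ge0 ?sqr_ge0 ?(ltW s0)// => h.
  by exfalso; have := sqr_ge0 x; lra.
(* x^2 + s <= 1 reads |x| <= c, and p^2 + s <= 2 p reads |p - 1| <= c. Since s = (1 - c)(1 + c),
   [stereo] maps 1 - c and 1 + c to -c and c; c < 1 keeps p positive. *)
pose c := Num.sqrt (1 - s).
have c0 : 0 <= c by exact: sqrtr_ge0.
have c2 : c ^+ 2 = 1 - s by rewrite sqr_sqrtr// subr_ge0.
have c1 : c < 1 by rewrite -(@ltr_pXn2r _ 2) ?nnegrE// expr1n c2; lra.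
have sE : s = (1 - c) * (1 + c) by rewrite -(subr_sqr 1 c) expr1n c2; ring.
have rpos x : 0 < Num.sqrt (x ^+ 2 + s) by rewrite sqrtr_gt0 ltr_wpDl// sqr_ge0.
pose G x := g (x / Num.sqrt (x ^+ 2 + s)).
have -> : (\int[mu]_x (cone_fun g ((x ^+ 2 + s)%R, x))%:E =
    \int[mu]_(x in `[(- c)%R, c]) (G x)%:E)%E.
  rewrite [RHS]integral_mkcond; apply: eq_integral => x _.
  rewrite patchE mem_setE in_itv/= -ler_norml /cone_fun/= rpos/=.
  have -> : (Num.sqrt (x ^+ 2 + s) <= 1) = (`|x| <= c).
    rewrite -[in LHS]sqrtr1 ler_psqrt ?nnegrE// ?addr_ge0 ?sqr_ge0 ?(ltW s0)//.
    rewrite -(@ler_pXn2r _ 2 _ `|x|) ?nnegrE// real_normK ?num_real// c2.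
    by apply/idP/idP; lra.
  by case: ifP.
have -> : (\int[mu]_p (stereo_cone g p (p^-1 ^+ 2 * s))%:E =
    \int[mu]_(p in `[(1 - c)%R, (1 + c)%R]) (((G \o stereo s) * (derive1 (stereo s))) p)%:E)%E.
  rewrite [RHS]integral_mkcond; apply: eq_integral => p _.
  rewrite patchE mem_setE in_itv/=; case: ifPn => [/andP[pl pr]|pN].
    have p0 : 0 < p by lra.
    have pn0 : p != 0 by rewrite gt_eqF.
    rewrite /stereo_cone p0 ifT/=; last first.
      rewrite -(ler_pM2l p0) (_ : p * (p * (1 + p^-1 ^+ 2 * s)) = p ^+ 2 + s); last by field.
      have : 0 <= (p - (1 - c)) * ((1 + c) - p) by rewrite mulr_ge0// subr_ge0.
      by rewrite [in X in _ -> X]sE; lra.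
    congr EFin; rewrite !fctE/= derive1E; have [_ ->] := is_derive_stereo s pn0.
    rewrite /G sqrt_stereo ?(ltW s0)//; congr (g _ * _); last by rewrite exprVn (mulrC s).
    have ps0 : p ^+ 2 + s != 0 by rewrite gt_eqF// addr_gt0// exprn_gt0.
    by rewrite /stereo; field; rewrite pn0 ps0.
  rewrite /stereo_cone; case: ifPn => // /andP[p0 ps].
  have pn0 : p != 0 by rewrite gt_eqF.
  exfalso; apply/negP : pN; rewrite negbK -ler_distlC.
  rewrite -(@ler_pXn2r _ 2) ?nnegrE// real_normK ?num_real// c2.
  move: ps; rewrite -(ler_pM2l p0).
  rewrite (_ : p * (p * (1 + p^-1 ^+ 2 * s)) = p ^+ 2 + s); last by field.
  by rewrite sqrrB expr1n; lra.
have stl : stereo s (1 - c) = - c.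
  by rewrite /stereo sE; field; rewrite subr_eq0 gt_eqF.
have str : stereo s (1 + c) = c.
  by rewrite /stereo sE; field; rewrite gt_eqF// ltr_wpDr.
rewrite -[in X in (\int[mu]_(x in X) _)%E]stl -[in X in `[_, X]]str.
rewrite integration_by_substitution_increasing//.
- lra.
- move=> x y; rewrite !in_itv/= => /andP[xl _] /andP[yl _] xy.
  have x0 : 0 < x by lra.
  have y0 : 0 < y by lra.
  rewrite /stereo ltr_pM2r// ltrD// ltrN2 ltr_pM2l// ltf_pV2 ?posrE//.
- move=> x; rewrite in_itv/= => /andP[xl _]; apply: continuous_derive1_stereo; lra.
- apply/cvg_ex; exists (derive1 (stereo s) (1 - c)); apply: cvg_at_right_filter.
  by apply: continuous_derive1_stereo; lra.
- apply/cvg_ex; exists (derive1 (stereo s) (1 + c)); apply: cvg_at_left_filter.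
  by apply: continuous_derive1_stereo; lra.
- split.
  + move=> x; rewrite in_itv/= => /andP[xl _].
    have x0 : x != 0 by rewrite gt_eqF//; lra.
    by have [] := is_derive_stereo s x0.
  + apply: cvg_at_right_filter; apply: continuous_stereo; rewrite gt_eqF//; lra.
  + apply: cvg_at_left_filter; apply: continuous_stereo; rewrite gt_eqF//; lra.
- apply: continuous_subspaceT => x.
  have rx := rpos x.
  apply: (@continuous_comp _ _ _ (fun x => x / Num.sqrt (x ^+ 2 + s)) g).
    apply: cvgM; first exact: cvg_id.
    apply: cvgV; first by rewrite gt_eqF.
    apply: (@continuous_comp _ _ _ (fun x : R => x ^+ 2 + s) Num.sqrt).
      by apply: cvgD; [apply: cvgM; exact: cvg_id|exact: cvg_cst].
    exact: sqrt_continuous.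
  apply: cg; rewrite -ltr_norml normrM normfV (gtr0_norm rx) ltr_pdivrMr// mul1r.
  rewrite -(@ltr_pXn2r _ 2) ?nnegrE ?(ltW rx)// real_normK ?num_real//.
  by rewrite sqr_sqrtr ?addr_ge0 ?sqr_ge0 ?(ltW s0)// ltrDl.
Qed.

End Stereographic.

(** * Zonal functions on the sphere *)

Section SphereIntegral.
Context {R : realType}.
Local Notation mu := (@lebesgue_measure R).

(** The inverse is obtained from a real power of the square, measurable everywhere; the factor [f x]
    restores the sign and settles f x = 0. *)
Lemma measurable_funV d (T : measurableType d) (f : T -> R) :
  measurable_fun setT f -> measurable_fun setT (fun x => (f x)^-1).
Proof.
move=> mf; have -> : (fun x => (f x)^-1) = (fun x => f x * (f x ^+ 2) `^ (-1)).
  apply/funext => x; rewrite powR_inv1 ?sqr_ge0//.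
  have [->|fx0] := eqVneq (f x) 0; first by rewrite invr0 mul0r.
  by field.
apply: measurable_funM => //; apply: (measurableT_comp (measurable_powR (-1))).
exact: measurable_funX.
Qed.

Lemma measurable_cone_fun (g : R -> R) : measurable_fun setT g ->
  measurable_fun setT (cone_fun g).
Proof.
move=> mg; have ms : measurable_fun setT (fun z : R * R => Num.sqrt z.1).
  apply: measurableT_comp => //; apply: continuous_measurable_fun.
  exact: sqrt_continuous.
apply: measurable_fun_ifT => //.
  by apply: measurable_and; [exact: measurable_fun_ltr|exact: measurable_fun_ler].
apply: measurableT_comp => //; apply: measurable_funM => //.
exact: measurable_funV.
Qed.

Lemma bounded_slab_cone_fun (M : R) (g : R -> R) : measurable_fun setT g ->
  (forall t, 0 <= g t) -> (forall t, g t <= M) -> bounded_slab M (cone_fun g).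
Proof.
move=> mg g0 gM; split; first exact: measurable_cone_fun.
- by move=> z; rewrite /cone_fun; case: ifP.
- by move=> z; rewrite /cone_fun; case: ifP => // _; apply: le_trans (gM 0).
- move=> z z1; rewrite /cone_fun; case: ifP => // /andP[_].
  by rewrite -[leRHS]sqrtr1 ler_psqrt ?nnegrE ?(le_trans ler01 (ltW z1))// leNgt z1.
Qed.

Lemma measurable_stereo_cone (g : R -> R) d (T : measurableType d) (p t : T -> R) :
  measurable_fun setT g -> measurable_fun setT p -> measurable_fun setT t ->
  measurable_fun setT (fun x => stereo_cone g (p x) (t x)).
Proof.
move=> mg mp mt; have m1 : measurable_fun setT (fun x => 1 + t x).
  exact: measurable_funD.
apply: measurable_fun_ifT => //.
  apply: measurable_and; first exact: measurable_fun_ltr.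
  by apply: measurable_fun_ler => //; exact: measurable_funM.
apply: measurable_funM; last exact: measurable_funM.
apply: measurableT_comp => //; apply: measurable_funM.
  exact: measurable_funB.
exact: measurable_funV.
Qed.

Lemma stereo_cone_ge0 (g : R -> R) (p t : R) : (forall u, 0 <= g u) ->
  0 <= t -> 0 <= stereo_cone g p t.
Proof.
move=> g0 t0; rewrite /stereo_cone; case: ifP => // _.
by rewrite mulr_ge0// divr_ge0// addr_ge0.
Qed.

Lemma integral_exprn n (C : R) : 0 < C ->
  (\int[mu]_(p in `[0%R, C]) (p ^+ n)%:E = (C ^+ n.+1 / n.+1%:R)%:E)%E.
Proof.
move=> C0; pose F (p : R) := n.+1%:R^-1 *: p ^+ n.+1.
have dF (p : R) : is_derive p 1 F (p ^+ n).
  have dX := DeriveDef (@exprn_derivable _ n.+1 p 1) (exp_derive n.+1 p 1).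
  have H : is_derive p 1 F _ := is_deriveZ n.+1%:R^-1 dX.
  apply: (is_derive_eq H); rewrite /GRing.scale/= mulr1 mulrA.
  by rewrite mulVf ?mul1r// pnatr_eq0.
have cF (p : R) : {for p, continuous F}.
  by apply/differentiable_continuous/derivable1_diffP; have [] := dF p.
rewrite (@continuous_FTC2 _ _ F)//.
- by rewrite -EFinB /F /GRing.scale/= expr0n/= mulr0 subr0 mulrC.
- by apply: continuous_subspaceT; exact: exprn_continuous.
- split; first by move=> p _; have [] := dF p.
  + by apply: cvg_at_right_filter; exact: cF.
  + by apply: cvg_at_left_filter; exact: cF.
- by move=> p _; rewrite derive1E; have [_ ->] := dF p.
Qed.

(** p runs up to C = 2 / (1 + t), and the Jacobian (1 + t) / 2 = 1 / C takes one power off C^(n+2) /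
    (n+2). The denominator is the dimension d, to be cancelled by the factor of the cone
    construction. *)
Lemma integral_stereo_cone n (g : R -> R) (t : R) : (forall u, 0 <= g u) -> 0 <= t ->
  (\int[mu]_p (p ^+ n.+1 * stereo_cone g p t)%:E =
   (g ((1 - t) / (1 + t)) * (2 / (1 + t)) ^+ n.+1 / n.+2%:R)%:E)%E.
Proof.
move=> g0 t0; have t1 : 0 < 1 + t by rewrite ltr_wpDr.
set w := g _; pose C := 2 / (1 + t); have C0 : 0 < C by rewrite divr_gt0.
transitivity (\int[mu]_(p in `[0%R, C]) ((w * ((1 + t) / 2))%:E * (p ^+ n.+1)%:E))%E.
  rewrite [RHS]integral_mkcond; apply: eq_integral => p _.
  rewrite patchE mem_setE in_itv/= /stereo_cone -ler_pdivlMr// -/C -/w.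
  have [p0|p0|<-] := ltgtP 0 p => /=; last 2 first.
  - by rewrite mulr0.
  - by rewrite mulr0 expr0n/= mule0; case: ifP.
  by case: ifP => _; rewrite ?mulr0// -EFinM mulrC.
rewrite ge0_integralZl//; last 3 first.
- by apply/measurable_EFinP; exact: exprn_measurable.
- by move=> p; rewrite /= in_itv/= => /andP[p0 _]; rewrite lee_fin exprn_ge0.
- by rewrite lee_fin mulr_ge0 ?divr_ge0// ?g0// ltW.
rewrite integral_exprn// -EFinM exprSr -/C; congr EFin.
have n2 : n.+2%:R != 0 :> R by rewrite pnatr_eq0.
move: (C ^+ n.+1) (n.+2%:R) n2 => u N N0; rewrite /C; field.
by rewrite N0 gt_eqF.
Qed.

(** Tonelli is used three times: the axis variable goes inside for the substitution at fixed s =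
    |y|^2, outside to rescale y at fixed p, and inside again to be integrated out. *)
Lemma linear_integral_cone n (m : n.+2.-tuple R) (M : R) (g : R -> R) : dotv m m = 1 ->
  measurable_fun setT g -> (forall t, 0 <= g t) -> (forall t, g t <= M) ->
  (forall t, -1 < t < 1 -> {for t, continuous g}) ->
  linear_integral m (EFin \o cone_fun g) (0, 0) =
  radial_integral n.+1
    (fun t => (g ((1 - t) / (1 + t)) * (2 / (1 + t)) ^+ n.+1 / n.+2%:R)%:E) 0.
Proof.
move=> m1 mg g0 gM cg; have [mF F0 _ _] := bounded_slab_cone_fun mg g0 gM.
have mF' : measurable_fun setT (EFin \o cone_fun g) by exact/measurable_EFinP.
have F0' z : (0 <= (EFin \o cone_fun g) z)%E by rewrite lee_fin F0.
have normm : Num.sqrt (\sum_(i <- m) i ^+ 2) = 1.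
  by rewrite -[RHS]sqrtr1 -m1 /dotv big_tuple.
move: normm (size_tuple m); case: (tval m) => // x l normm [sl].
rewrite linear_integral_rotation// normm sl.
pose f1 (z : R * R) := (cone_fun g (z.1 ^+ 2 + z.2, z.1))%:E.
have mf1 : measurable_fun setT f1.
  apply/measurable_EFinP; apply: measurableT_comp => //; apply: measurable_fun_pair => //.
  by apply: measurable_funD => //; exact: measurable_funX.
transitivity (\int[mu]_x radial_integral n.+1 (fun s => f1 (x, s)) 0)%E.
  apply: eq_integral => y _; rewrite (add0r (y ^+ 2)) -{1}[y ^+ 2]addr0 radial_integral_shift.
  by apply: eq_radial_integral => s _; rewrite /f1/= add0r mul1r.
rewrite radial_integral_tonelli//; last by move=> z; exact: F0'.
(* The absolute values here and in [f3] give nonnegativity for all arguments, as Tonelli requires;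
   they disappear on the domain actually integrated over. *)
pose f2 (z : R * R) := (stereo_cone g z.1 (z.1^-1 ^+ 2 * `|z.2|))%:E.
have mf2 : measurable_fun setT f2.
  apply/measurable_EFinP; apply: measurable_stereo_cone => //.
  apply: measurable_funM; last exact: measurableT_comp.
  by apply: measurable_funX; exact: measurable_funV.
have f20 z : (0 <= f2 z)%E.
  by rewrite lee_fin stereo_cone_ge0// mulr_ge0// sqr_ge0.
pose swap (f : R * R -> \bar R) (z : R * R) := f (z.2, z.1).
have mswap f : measurable_fun setT f -> measurable_fun setT (swap f).
  by move=> mf; apply: measurableT_comp => //; exact: measurable_fun_pair.
rewrite (@radial_integralS_eq _ _ _ (fun s => \int[mu]_p f2 (p, s))%E); last 5 first.
- exact: (measurable_integral (mswap _ mf1) (fun z => F0' _)).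
- exact: (measurable_integral (mswap _ mf2) (fun z => f20 _)).
- by move=> s; apply: integral_ge0 => y _; exact: F0'.
- by move=> s; apply: integral_ge0 => y _; exact: f20.
- move=> s s0; rewrite /f1/= integral_stereo//.
  by apply: eq_integral => p _; rewrite /f2/= ger0_norm// ltW.
rewrite -radial_integral_tonelli//.
pose f3 (z : R * R) := (`|z.1| ^+ n.+1 * stereo_cone g z.1 `|z.2|)%:E.
have mf3 : measurable_fun setT f3.
  apply/measurable_EFinP; apply: measurable_funM.
    by apply: measurable_funX; exact: measurableT_comp.
  by apply: measurable_stereo_cone => //; exact: measurableT_comp.
have f30 z : (0 <= f3 z)%E by rewrite lee_fin mulr_ge0 ?exprn_ge0 ?stereo_cone_ge0.
transitivity (\int[mu]_p radial_integral n.+1 (fun s => f3 (p, s)) 0)%E.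
  apply: eq_integral => p _; have [p0|p0] := ltP 0 p; last first.
    apply: eq_radial_integral => s s0.
    by rewrite /f2 /f3 /stereo_cone/= ltNge p0/= mulr0.
  pose G (s : R) := (stereo_cone g p `|s|)%:E.
  have mG : measurable_fun setT G.
    by apply/measurable_EFinP; apply: measurable_stereo_cone.
  have G0 s : (0 <= G s)%E by rewrite lee_fin stereo_cone_ge0.
  have pV0 : 0 < p^-1 by rewrite invr_gt0.
  transitivity (radial_integral n.+1 (fun s => G (p^-1 ^+ 2 * s)) 0).
    apply: eq_radial_integral => s s0; rewrite /f2 /G/= normrM.
    by rewrite (ger0_norm (sqr_ge0 _)).
  (* Scaling the n+1 variables by 1 / p yields the Jacobian p^(n+1). *)
  rewrite radial_integral_scale// mulr0 -radial_integralZl//; last first.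
    by rewrite invr_ge0 exprn_ge0// ltW.
  apply: eq_radial_integral => s s0; rewrite /f3/= -EFinM exprVn invrK.
  by rewrite (gtr0_norm p0).
rewrite radial_integral_tonelli//; apply: eq_radial_integral => t t0.
rewrite -integral_stereo_cone//; apply: eq_integral => p _.
rewrite /f3/= (ger0_norm t0) /stereo_cone.
by case: ifP => [/andP[p0 _]|_]; rewrite ?mulr0// gtr0_norm.
Qed.

Lemma dotv_scalev d (m x : d.-tuple R) (c : R) : dotv m (scalev c x) = c * dotv m x.
Proof.
rewrite /dotv mulr_sumr; apply: eq_bigr => i _.
by rewrite tnth_map mulrCA.
Qed.

Lemma dotv_ge0 d (x : d.-tuple R) : 0 <= dotv x x.
Proof. by apply: sumr_ge0 => i _; rewrite -expr2 sqr_ge0. Qed.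

(** Cauchy-Schwarz, from |x|^2 - t^2 = |x - t m|^2 with t = m . x. *)
Lemma dotv_unit_le d (m x : d.-tuple R) : dotv m m = 1 -> `|dotv m x| <= normv x.
Proof.
move=> m1; rewrite -(@ler_pXn2r _ 2) ?nnegrE ?sqrtr_ge0//.
rewrite sqr_sqrtr ?dotv_ge0// real_normK ?num_real// -subr_ge0.
have [t tE] : exists t, t = dotv m x by exists (dotv m x).
rewrite -tE.
have -> : dotv x x - t ^+ 2 = \sum_(i < d) (tnth x i - t * tnth m i) ^+ 2.
  transitivity (dotv x x - 2 * t * dotv m x + t ^+ 2 * dotv m m).
    by rewrite m1 -tE; ring.
  rewrite /dotv !mulr_sumr -sumrB -big_split/=; apply: eq_bigr => i _.
  by ring.
by apply: sumr_ge0 => i _; rewrite sqr_ge0.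
Qed.

Lemma sphere_integral_zonal n (m : n.+2.-tuple R) (M A B : R) (f g : R -> R)
    (h : n.+2.-tuple R -> R) : dotv m m = 1 ->
  measurable_fun setT f -> (forall t, 0 <= f t) -> (forall t, f t <= M) ->
  (forall t, -1 < t < 1 -> {for t, continuous f}) ->
  measurable_fun setT g -> (forall t, 0 <= g t) -> (forall t, g t <= M) ->
  (forall t, -1 < t < 1 -> {for t, continuous g}) ->
  (forall x, `|dotv m x| <= 1 -> h x = A * f (dotv m x) + B * g (dotv m x)) ->
  let S (f : R -> R) := fine (radial_integral n.+1
    (fun t => (f ((1 - t) / (1 + t)) * (2 / (1 + t)) ^+ n.+1)%:E) 0) in
  sphere_integral h = A * S f + B * S g.
Proof.
move=> m1 mf f0 fM cf mg g0 gM cg hE S.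
have sf := bounded_slab_cone_fun mf f0 fM.
have sg := bounded_slab_cone_fun mg g0 gM.
have SE (u : R -> R) : measurable_fun setT u -> (forall t, 0 <= u t) -> (forall t, u t <= M) ->
    (forall t, -1 < t < 1 -> {for t, continuous u}) ->
    S u = n.+2%:R * fine (linear_integral m (EFin \o cone_fun u) (0, 0)).
  move=> mu' u0 uM cu; have su := bounded_slab_cone_fun mu' u0 uM.
  rewrite -[n.+2%:R]/(fine n.+2%:R%:E) -fineM ?(linear_integral_fin_num _ su)//.
  rewrite (linear_integral_cone m1 mu' u0 uM cu).
  congr fine; symmetry.
  pose P (t : R) : R := 2 / (1 + `|t|).
  pose H (t : R) := (u ((1 - t) / (1 + t)) * P t ^+ n.+1 / n.+2%:R)%:E.
  have mH : measurable_fun setT H.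
    apply/measurable_EFinP; apply: measurable_funM => //; apply: measurable_funM.
      apply: measurableT_comp => //; apply: measurable_funM; first exact: measurable_funB.
      by apply: measurable_funV; exact: measurable_funD.
    apply: measurable_funX; apply: measurable_funM => //; apply: measurable_funV.
    exact: measurable_funD.
  have H0 t : (0 <= H t)%E.
    by rewrite lee_fin divr_ge0// mulr_ge0// exprn_ge0// divr_ge0// addr_ge0.
  transitivity (n.+2%:R%:E * radial_integral n.+1 H 0)%E.
    congr (_ * _)%E; apply: eq_radial_integral => t t0.
    by rewrite /H /P ger0_norm.
  rewrite -radial_integralZl//; apply: eq_radial_integral => t t0.
  by rewrite /H /P ger0_norm// -EFinM mulrC divfK.
rewrite !SE// /sphere_integral mulrCA (mulrCA B) -mulrDr; congr (_ * _).
rewrite -(lebesgue_int_linear m 0 A B sf sg (lexx 0)); congr lebesgue_int.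
apply/funext => x; rewrite !add0r /cone_fun/= -/(normv x).
case: ifPn => [/andP[x0 _]|_]; last by rewrite !mulr0 addr0.
rewrite hE dotv_scalev ?[_^-1 * _]mulrC//.
by rewrite normrM normfV (gtr0_norm x0) ler_pdivrMr// mul1r dotv_unit_le.
Qed.

End SphereIntegral.

(** * Entropy *)

Section Entropy.
Context {R : realType}.

(* Clipped outside [-1, 1], where it is never evaluated, so as to be bounded. *)
Definition half_height (t : R) : R := if `|t| <= 1 then (1 + t) / 2 else 0.

Lemma half_heightE t : `|t| <= 1 -> half_height t = (1 + t) / 2.
Proof. by rewrite /half_height => ->. Qed.

Lemma half_height_itv t : 0 <= half_height t <= 1.
Proof.
rewrite /half_height; case: ifPn => [|_]; last by rewrite lexx ler01.
by rewrite ler_norml => /andP[? ?]; apply/andP; split; lra.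
Qed.

Lemma half_height_stereo t : 0 <= t -> half_height ((1 - t) / (1 + t)) = (1 + t)^-1.
Proof.
move=> t0; have t1 : 0 < 1 + t by rewrite ltr_wpDr.
rewrite half_heightE; first by field; rewrite gt_eqF.
rewrite ler_norml ler_pdivlMr// ler_pdivrMr//; apply/andP; split; lra.
Qed.

Lemma measurable_half_height : measurable_fun setT half_height.
Proof.
apply: measurable_fun_ifT => //; first exact: measurable_fun_ler.
by apply: measurable_funM => //; exact: measurable_funD.
Qed.

Lemma continuous_half_height t : -1 < t < 1 -> {for t, continuous half_height}.
Proof.
move=> t1; have t1' : `|t| < 1 by rewrite ltr_norml.
rewrite /prop_for /continuous_at half_heightE ?ltW//.
apply: (@cvg_trans _ ((fun x : R => (1 + x) / 2) @ t)).
  apply: near_eq_cvg; near=> x; rewrite half_heightE//.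
  have : x \in `]-1, 1[ by near: x; exact: near_in_itvoo.
  by rewrite in_itv/= -ltr_norml => /ltW.
suff : {for t, continuous (fun x : R => (1 + x) / 2)} by [].
apply/differentiable_continuous/derivable1_diffP.
by apply: derivableM; [exact: derivableD|exact: derivable_cst].
Unshelve. all: by end_near. Qed.

(** Halving 1 + t confines the power to [0, 1] for kappa >= 0, so that its logarithm has a constant
    sign; [ps_unnormE] restores the factor 2^kappa. *)
Definition zonal_power (kappa t : R) : R := half_height t `^ kappa.

Definition zonal_entropy (kappa t : R) : R :=
  - (zonal_power kappa t * ln (zonal_power kappa t)).

Lemma zonal_power_itv (kappa t : R) : 0 <= kappa -> 0 <= zonal_power kappa t <= 1.
Proof.
move=> k0; rewrite /zonal_power powR_ge0/=; have /andP[w0 w1] := half_height_itv t.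
have [->|k1] := eqVneq kappa 0; first by rewrite powRr0.
have := @ge0_ler_powR R kappa k0 (half_height t) 1.
by rewrite powR1 !nnegrE; apply.
Qed.

(** For y > 0 the upper bound is ln u < u at u = 1 / y. *)
Lemma zonal_entropy_itv (kappa t : R) : 0 <= kappa -> 0 <= zonal_entropy kappa t <= 1.
Proof.
move=> k0; rewrite /zonal_entropy; have := zonal_power_itv t k0.
move: (zonal_power kappa t) => y /andP[y0 y1].
rewrite -mulrN mulr_ge0//= ?oppr_ge0 ?ln_le0//.
have [->|yn0] := eqVneq y 0; first by rewrite mul0r.
have yp : 0 < y by rewrite lt_neqAle eq_sym yn0.
rewrite -lnV ?posrE// mulrC -ler_pdivlMr// mul1r ltW// ln_sublinear//.
by rewrite invr_gt0.
Qed.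

Lemma measurable_zonal_power kappa : measurable_fun setT (zonal_power kappa).
Proof.
exact: (measurableT_comp (measurable_powR kappa) measurable_half_height).
Qed.

Lemma measurable_zonal_entropy kappa : measurable_fun setT (zonal_entropy kappa).
Proof.
have mp := measurable_zonal_power kappa.
apply: measurable_funN; apply: measurable_funM => //.
exact: (measurableT_comp (@measurable_ln R) mp).
Qed.

Lemma half_height_gt0 t : -1 < t < 1 -> 0 < half_height t.
Proof.
move=> t1; rewrite half_heightE; last by rewrite ltW// ltr_norml.
by move: t1 => /andP[? ?]; lra.
Qed.

Lemma continuous_zonal_power kappa t : -1 < t < 1 ->
  {for t, continuous (zonal_power kappa)}.
Proof.
move=> t1; have w0 := half_height_gt0 t1.
apply: (@continuous_comp _ _ _ half_height (fun x : R => x `^ kappa)).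
  exact: continuous_half_height.
apply/differentiable_continuous/derivable1_diffP.
by apply: derivable_powR; rewrite in_itv/= w0.
Qed.

Lemma continuous_zonal_entropy kappa t : -1 < t < 1 ->
  {for t, continuous (zonal_entropy kappa)}.
Proof.
move=> t1; have w0 := half_height_gt0 t1.
have cz := continuous_zonal_power (kappa := kappa) t1.
apply: cvgN; apply: cvgM; first exact: cz.
apply: (@continuous_comp _ _ _ (zonal_power kappa) (@ln R)); first exact: cz.
by apply: continuous_ln; exact: powR_gt0.
Qed.

Lemma zonal_power_stereo n (kappa t : R) : 0 <= t ->
  zonal_power kappa ((1 - t) / (1 + t)) * (2 / (1 + t)) ^+ n =
  2 ^+ n * (1 + t) `^ (- (n%:R + kappa)).
Proof.
move=> t0; have t1 : 0 < 1 + t by rewrite ltr_wpDr.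
rewrite /zonal_power half_height_stereo// -(powR_inv1 (ltW t1)) -powRrM mulN1r.
rewrite exprMn mulrCA; congr (_ * _).
rewrite -(powR_mulrn n (powR_ge0 _ _)) -powRrM mulN1r -powRD ?(gt_eqF t1) ?implybT//.
by congr (_ `^ _); ring.
Qed.

Lemma ln_zonal_power_stereo (kappa t : R) : 0 <= t ->
  ln (zonal_power kappa ((1 - t) / (1 + t))) = - (kappa * ln (1 + t)).
Proof.
move=> t0; have t1 : 0 < 1 + t by rewrite ltr_wpDr.
by rewrite /zonal_power half_height_stereo// ln_powR lnV ?posrE// mulrN.
Qed.

Lemma radial_integral_zonal_power n (kappa : R) : 0 <= kappa ->
  radial_integral n.+1 (fun t =>
    (zonal_power kappa ((1 - t) / (1 + t)) * (2 / (1 + t)) ^+ n.+1)%:E) 0 =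
  (2 ^+ n.+1 * power_moment (n.+1%:R / 2) (n.+1%:R + kappa))%:E.
Proof.
move=> k0; pose a := n.+1%:R + kappa.
have na : n.+1%:R / 2 < a by have : 0 < n.+1%:R :> R by []; rewrite /a; lra.
rewrite [RHS]EFinM -(radial_integral_powR na) -radial_integralZl//.
- by apply: eq_radial_integral => t t0; rewrite zonal_power_stereo// EFinM.
- apply/measurable_EFinP; apply: (measurableT_comp (measurable_powR (- a))).
  exact: measurable_funD.
- by move=> t; rewrite lee_fin powR_ge0.
Qed.

Lemma radial_integral_zonal_entropy n (kappa : R) : 0 <= kappa ->
  radial_integral n.+1 (fun t =>
    (zonal_entropy kappa ((1 - t) / (1 + t)) * (2 / (1 + t)) ^+ n.+1)%:E) 0 =
  (2 ^+ n.+1 * kappa * (power_moment (n.+1%:R / 2) (n.+1%:R + kappa) *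
    (digamma (n.+1%:R + kappa) - digamma (n.+1%:R + kappa - n.+1%:R / 2))))%:E.
Proof.
move=> k0; pose a := n.+1%:R + kappa.
have na : n.+1%:R / 2 < a by have : 0 < n.+1%:R :> R by []; rewrite /a; lra.
rewrite [RHS]EFinM -(radial_integral_powR_ln na)//.
pose q (t : R) := (1 + t) `^ (- a) * ln (1 + `|t|).
have q0 t : 0 <= q t by rewrite mulr_ge0 ?powR_ge0// ln_ge0// lerDl.
transitivity ((2 ^+ n.+1 * kappa)%:E * radial_integral n.+1 (fun t => (q t)%:E) 0)%E.
  rewrite -radial_integralZl//; last 2 first.
  - apply/measurable_EFinP; apply: measurable_funM.
      apply: (measurableT_comp (measurable_powR (- a))).
      exact: measurable_funD.
    apply: (measurableT_comp (@measurable_ln R)).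
    exact: measurable_funD.
  - by rewrite mulr_ge0// exprn_ge0.
  apply: eq_radial_integral => t t0; rewrite -EFinM; congr EFin.
  rewrite /zonal_entropy ln_zonal_power_stereo// mulrN opprK mulrAC zonal_power_stereo//.
  by rewrite /q ger0_norm//; ring.
congr (_ * _)%E; apply: eq_radial_integral => t t0.
by rewrite /q ger0_norm.
Qed.

(** Used twice: with B = 0 for the normalizer, with both coefficients for the entropy. *)
Lemma sphere_integral_zonal_power n (m : n.+2.-tuple R) (kappa A B : R)
    (h : n.+2.-tuple R -> R) : dotv m m = 1 -> 0 <= kappa ->
  (forall x, `|dotv m x| <= 1 -> h x =
    A * zonal_power kappa (dotv m x) + B * zonal_entropy kappa (dotv m x)) ->
  let a := n.+1%:R + kappa in let b := n.+1%:R / 2 in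
  sphere_integral h = 2 ^+ n.+1 * power_moment b a *
    (A + B * kappa * (digamma a - digamma (a - b))).
Proof.
move=> m1 k0 hE a b.
rewrite (@sphere_integral_zonal _ _ m 1 A B (zonal_power kappa) (zonal_entropy kappa) h m1).
- rewrite radial_integral_zonal_power// radial_integral_zonal_entropy//= -/a -/b.
  move: (power_moment b a) (digamma a) (digamma (a - b)) (2 ^+ n.+1) => V x y z.
  by ring.
- exact: measurable_zonal_power.
- by move=> t; have /andP[] := zonal_power_itv t k0.
- by move=> t; have /andP[] := zonal_power_itv t k0.
- exact: continuous_zonal_power.
- exact: measurable_zonal_entropy.
- by move=> t; have /andP[] := zonal_entropy_itv t k0.
- by move=> t; have /andP[] := zonal_entropy_itv t k0.
- exact: continuous_zonal_entropy.
- exact: hE.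
Qed.

Lemma ps_unnormE d (m x : d.-tuple R) (kappa : R) : `|dotv m x| <= 1 ->
  ps_unnorm m kappa x = 2 `^ kappa * zonal_power kappa (dotv m x).
Proof.
move=> mx; have /andP[w0 _] := half_height_itv (dotv m x).
rewrite /zonal_power -powRM// half_heightE// /ps_unnorm; congr (_ `^ _).
by field.
Qed.

Lemma ps_normalizerE n (m : n.+2.-tuple R) (kappa : R) : dotv m m = 1 -> 0 <= kappa ->
  ps_normalizer m kappa =
  2 ^+ n.+1 * power_moment (n.+1%:R / 2) (n.+1%:R + kappa) * 2 `^ kappa.
Proof.
move=> m1 k0; rewrite /ps_normalizer.
rewrite (@sphere_integral_zonal_power _ m kappa (2 `^ kappa) 0)//.
  by rewrite !mul0r addr0.
by move=> x mx; rewrite ps_unnormE// mul0r addr0.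
Qed.

(** For y = 0 the logarithm of the product does not split, but both sides vanish; this covers the
    zeros of the density. *)
Lemma xlnxM (c y : R) : 0 < c -> 0 <= y ->
  (c * y) * ln (c * y) = c * ln c * y + c * (y * ln y).
Proof.
move=> c0; rewrite le_eqVlt => /predU1P[<-|y0]; first by rewrite !(mulr0, mul0r) addr0.
by rewrite lnM ?posrE//; ring.
Qed.

Lemma ps_entropyE n (m : n.+2.-tuple R) (kappa : R) : dotv m m = 1 -> 0 <= kappa ->
  let a := n.+1%:R + kappa in
  ps_entropy m kappa = ln (ps_normalizer m kappa) -
    kappa * (ln 2 + digamma (a - n.+1%:R / 2) - digamma a).
Proof.
move=> m1 k0 a; set b := n.+1%:R / 2; set Z := ps_normalizer m kappa.
have n0 : 0 < n.+1%:R :> R by [].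
have b0 : 0 < b by rewrite divr_gt0.
have ba : b < a by rewrite /a /b; lra.
have V0 := power_moment_gt0 b0 ba.
have p2 : 0 < 2 `^ kappa :> R by exact: powR_gt0.
have ZE : Z = 2 ^+ n.+1 * power_moment b a * 2 `^ kappa by exact: ps_normalizerE.
have Z0 : 0 < Z.
  by rewrite ZE; apply: mulr_gt0 => //; apply: mulr_gt0 => //; exact: exprn_gt0.
pose c := 2 `^ kappa / Z; have c0 : 0 < c by rewrite divr_gt0.
have lnc : ln c = kappa * ln 2 - ln Z by rewrite ln_div ?posrE// ln_powR.
(* With y the zonal power, p ln p = (c ln c) y + c (y ln y); the second coefficient is - c because
   [zonal_entropy] is - y ln y. *)
rewrite /ps_entropy (@sphere_integral_zonal_power _ m kappa (c * ln c) (- c))//; last first.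
  move=> x mx; have /andP[y0 _] := zonal_power_itv (dotv m x) k0.
  have -> : ps_density m kappa x = c * zonal_power kappa (dotv m x).
    by rewrite /ps_density -/Z ps_unnormE// mulrAC.
  by rewrite (xlnxM c0 y0) mulrNN.
rewrite -/a -/b lnc.
(* The density has total mass 1. *)
have cZ : 2 ^+ n.+1 * power_moment b a * c = 1.
  by rewrite /c mulrA -ZE mulfV// gt_eqF.
have E u v : 2 ^+ n.+1 * power_moment b a * (c * u + - c * kappa * v) = u - kappa * v.
  transitivity (2 ^+ n.+1 * power_moment b a * c * (u - kappa * v)).
    by move: (2 ^+ n.+1 * power_moment b a) => V; ring.
  by rewrite cZ mul1r.
rewrite E.
by move: (digamma a) (digamma (a - b)) (ln Z) => x y z; ring.
Qed.

End Entropy.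

Theorem theorem15 (R : realType) (d : nat) (mu : d.-tuple R) (kappa : R) :
  (2 <= d)%N -> dotv mu mu = 1 -> 0 <= kappa ->
  ps_entropy mu kappa =
    ln (NX kappa d)
    - kappa * (ln 2 + digamma (ps_alpha d kappa)
               - digamma (ps_alpha d kappa + ps_beta d)).
Proof.
case: d mu => [//|[//|n]] mu _ m1 k0.
have be : ps_beta n.+2 = n.+1%:R / 2 :> R.
  by rewrite /ps_beta -[n.+2]addn1 natrD addrK.
have al : ps_alpha n.+2 kappa = n.+1%:R + kappa - n.+1%:R / 2.
  by rewrite /ps_alpha -/(ps_beta n.+2) be; lra.
have ab : ps_alpha n.+2 kappa + ps_beta n.+2 = n.+1%:R + kappa.
  by rewrite al be subrK.
rewrite (ps_entropyE m1 k0) (ps_normalizerE m1 k0) /NX ab al be.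
(* 2^(alpha + beta) collects 2^(d-1) from the stereographic Jacobian and 2^kappa from the halved
   height; the remaining factors of [NX] are the power moment. *)
suff -> : 2 `^ (n.+1%:R + kappa) = 2 ^+ n.+1 * 2 `^ kappa :> R.
  rewrite /power_moment; congr (ln _ - _).
  move: (Gamma _) (Gamma _) (2 `^ kappa) (pi `^ _) (2 ^+ n.+1) => x y z t u.
  by ring.
by rewrite powRD ?powR_mulrn// pnatr_eq0 implybT.
Qed.
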